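(* There exists $n_0$ such that for every integer $n\geq n_0$ divisible by $3$ the following holds. Let $G$ be a triangle-free graph on $n$ vertices. Then \[ D_3^b(G)\leq \frac{n^2}{36}. \] Additionally, if $D_3^b(G)=\frac{n^2}{36}$, then $G\cong K_{\frac{5n}{6},\frac{n}{6}}$ or $G\cong K_{\frac{n}{2},\frac{n}{2}}$.
   Context: For a graph $G$ and $A\subseteq V(G)$, $e(A)$ denotes the number of edges of $G$ with both endpoints in $A$. A $k$-partition $V(G)=A_1\cup\dots\cup A_k$ is balanced if $|A_i|=|A_j|$ for all $i,j$. $D_k^b(G)=\min \sum_{i=1}^k e(A_i)$, where the minimum is over all balanced $k$-partitions of $V(G)$. $K_{a,b}$ is the complete bipartite graph with class sizes $a$ and $b$. *)

(* Defs.v *)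
From mathcomp Require Import all_boot all_order all_algebra.

Set Implicit Arguments.
Unset Strict Implicit.
Unset Printing Implicit Defensive.

Record sgraph := SGraph {
  vertex :> finType;
  adj : rel vertex;
  adj_sym : symmetric adj;
  adj_irrefl : irreflexive adj
}.

Definition triangle_free (G : sgraph) : Prop :=
  forall x y z : G, ~~ [&& adj x y, adj y z & adj z x].

Definition edges (G : sgraph) : {set {set G}} :=
  [set [set p.1; p.2] | p : G * G & adj p.1 p.2].

(* The paper's e(A). *)
Definition num_edges (G : sgraph) (A : {set G}) : nat :=
  #|[set E in edges G | E \subset A]|.

(* Partitions are indexed families; [finset.partition] is not used since it
   is about unindexed collections of nonempty blocks. *)
Definition balanced_partition (k : nat) (G : sgraph)
    (A : {ffun 'I_k -> {set G}}) : bool :=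
  [&& \bigcup_(i < k) A i == [set: G],
      [forall i, forall j, (i != j) ==> [disjoint A i & A j]] &
      [forall i, forall j, #|A i| == #|A j|]].

Definition partition_cost (k : nat) (G : sgraph)
    (A : {ffun 'I_k -> {set G}}) : nat :=
  \sum_(i < k) num_edges (A i).

(* The paper's D_k^b(G); the value 0 is junk, taken only when G has no
   balanced k-partition (see [Dbal_min] and [balanced_partition_exists]). *)
Definition Dbal (k : nat) (G : sgraph) : nat :=
  if [pick A | @balanced_partition k G A] is Some A0 then
    partition_cost
      [arg min_(A < A0 | balanced_partition A) partition_cost A]
  else 0.

Lemma Dbal_min (k : nat) (G : sgraph) :
  (exists A, @balanced_partition k G A) ->
  (exists2 A, @balanced_partition k G A & Dbal k G = partition_cost A) /\
  (forall A, @balanced_partition k G A -> Dbal k G <= partition_cost A).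
Proof.
case=> A1 balA1; rewrite /Dbal.
case: pickP => [A0 balA0|/(_ A1)]; last by rewrite balA1.
by case: arg_minnP => // A balA minA; split=> //; exists A.
Qed.

Lemma balanced_partition_exists (k : nat) (G : sgraph) :
  0 < k -> k %| #|G| -> exists A, @balanced_partition k G A.
Proof.
move=> k_gt0 /dvdnP[m cardG].
have eqGP : #|G| = #|{: 'I_k * 'I_m}|.
  by rewrite cardG card_prod !card_ord mulnC.
pose g (x : G) := enum_val (cast_ord eqGP (enum_rank x)).
pose h p : G := enum_val (cast_ord (esym eqGP) (enum_rank p)).
have gK : cancel g h by move=> x; rewrite /g /h enum_valK cast_ordK enum_rankK.
have hK : cancel h g by move=> p; rewrite /g /h enum_valK cast_ordKV enum_rankK.
pose A := [ffun i : 'I_k => [set x | (g x).1 == i]].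
have cardA i : #|A i| = m.
  have -> : A i = [set h (i, j) | j : 'I_m].
    apply/setP=> x; rewrite ffunE inE; apply/eqP/imsetP=> [<-|[j _ ->]].
      by exists (g x).2; rewrite // -surjective_pairing gK.
    by rewrite hK.
  by rewrite card_imset ?card_ord // => j j' /(can_inj hK)[].
exists A; apply/and3P; split.
- rewrite -subTset; apply/subsetP=> x _; apply/bigcupP.
  by exists (g x).1; rewrite // ffunE inE.
- apply/forallP=> i; apply/forallP=> j; apply/implyP=> neq_ij.
  rewrite -setI_eq0; apply/eqP/setP=> x; rewrite !ffunE !inE.
  by apply/andP=> -[/eqP-> /eqP eq_ij]; rewrite eq_ij eqxx in neq_ij.
- by apply/forallP=> i; apply/forallP=> j; rewrite !cardA.
Qed.

Definition isomorphic (G H : sgraph) : Prop :=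
  exists2 f : G -> H, bijective f & forall x y, adj (f x) (f y) = adj x y.

Definition Kbip_adj (a b : nat) : rel ('I_a + 'I_b) :=
  fun x y => match x, y with
             | inl _, inr _ | inr _, inl _ => true
             | _, _ => false
             end.

Lemma Kbip_adj_sym (a b : nat) : symmetric (@Kbip_adj a b).
Proof. by case=> ? []. Qed.

Lemma Kbip_adj_irrefl (a b : nat) : irreflexive (@Kbip_adj a b).
Proof. by case. Qed.

Definition Kbip (a b : nat) : sgraph :=
  SGraph (@Kbip_adj_sym a b) (@Kbip_adj_irrefl a b).

(* Main.v *)
(* Put n = 3m. By pipage rounding, D_3^b(G) is at most the cost of every fractional
   balanced 3-colouring, and strictly less if the ends of some edge share two
   colours with positive weight. It thus suffices to exhibit cheap fractional
   colourings.

   If e(G) <= n^2/12, colour uniformly. If there are two disjoint independent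
   m-sets, complete them by the remaining m vertices, which span at most m^2/4
   edges by Mantel's theorem. If there is an independent m-set but none in its
   complement, bisect the complement into a neighbourhood N(v) enlarged by a
   fraction of the rest, with v chosen by averaging; the average is controlled by a
   lower bound on the quadratic form of a triangle-free graph.

   If every independent set has fewer than m vertices and e(G) > n^2/12, take the
   vertex u where a Perron vector is maximal and v where it is maximal on N(u).
   Three fractional colourings built on the independent sets N(u) and N(v), which
   are large because the spectral radius exceeds m/2, cannot all cost at least
   m^2/4; this is a polynomial inequality in three variables, certified by
   subdividing a box until all Bernstein coefficients are positive.

   Equality only survives with two disjoint independent m-sets, the third class
   then being a balanced complete bipartite graph. Further exchanges show that each
   independent class is completely joined to one side of it, and both choices yield
   one of the two extremal graphs. *)
Require Import Defs.
From Stdlib Require Import ZArith.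
From mathcomp Require Import all_boot all_order all_algebra.
From mathcomp Require Import spectral complex realalg.
From mathcomp Require Import ring lra zify ssrZ.

Set Implicit Arguments.
Unset Strict Implicit.
Unset Printing Implicit Defensive.
Import Order.TTheory GRing.Theory Num.Theory.
Local Open Scope ring_scope.

(** * Edge counts as quadratic forms *)

(** Edges are counted through the quadratic form of the adjacency matrix, so that sets and
    fractional classes obey the same identities. Rounding loses nothing: the exchange directions
    have nonpositive cost, so the cost is concave along them. This is why the bound has no
    lower-order error and holds for every n >= 1. In the case without large independent sets, the
    obstacle is rho, the number of edges avoiding both N(u) and N(v), which is only known from
    below. The inequalities are therefore combined with weights that cancel rho, or rho is replaced
    by its lower bound where its coefficient is nonpositive. The Perron vector serves because it
    controls both neighbourhoods of an edge at once: with l the spectral radius and t = l / deg u,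
    it gives deg v >= l t, hence deg u deg v >= l^2, and degree sums over N(u) and N(v) of at least
    l^2 and t l^2. *)

Section Form.
Variables (G : sgraph) (R : realFieldType).
Implicit Types (f g h : G -> R) (z w : G).

Definition adjr z w : R := (adj z w)%:R.
Definition mdeg f z : R := \sum_w adjr z w * f w.
Definition mass f : R := \sum_z f z.
Definition qform f g : R := \sum_z f z * mdeg g z.
Definition ind (A : {set G}) z : R := (z \in A)%:R.

Lemma adjrC z w : adjr z w = adjr w z.
Proof. by rewrite /adjr adj_sym. Qed.

Lemma adjr_ge0 z w : 0 <= adjr z w.
Proof. exact: ler0n. Qed.

Lemma adjr_le1 z w : adjr z w <= 1.
Proof. by rewrite /adjr lern1 leq_b1. Qed.

Lemma eq_mdeg f g z : f =1 g -> mdeg f z = mdeg g z.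
Proof. by move=> eq_fg; apply: eq_bigr => w _; rewrite eq_fg. Qed.

Lemma eq_qform f f' g g' : f =1 f' -> g =1 g' -> qform f g = qform f' g'.
Proof.
by move=> ff' gg'; apply: eq_bigr => z _; rewrite ff' (eq_mdeg z gg').
Qed.

Lemma eq_mass f g : f =1 g -> mass f = mass g.
Proof. by move=> eq_fg; apply: eq_bigr => w _; rewrite eq_fg. Qed.

Lemma mdegD f g z : mdeg (fun w => f w + g w) z = mdeg f z + mdeg g z.
Proof. by rewrite -big_split; apply: eq_bigr => w _; rewrite mulrDr. Qed.

Lemma mdegZ c f z : mdeg (fun w => c * f w) z = c * mdeg f z.
Proof. by rewrite /mdeg mulr_sumr; apply: eq_bigr => w _; rewrite mulrCA. Qed.

Lemma massD f g : mass (fun w => f w + g w) = mass f + mass g.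
Proof. exact: big_split. Qed.

Lemma massZ c f : mass (fun w => c * f w) = c * mass f.
Proof. by rewrite /mass mulr_sumr. Qed.

Lemma qformC f g : qform f g = qform g f.
Proof.
rewrite /qform /mdeg.
under eq_bigr => z _ do rewrite mulr_sumr.
rewrite exchange_big; apply: eq_bigr => w _; rewrite mulr_sumr.
by apply: eq_bigr => z _; rewrite adjrC; ring.
Qed.

Lemma qformDl f g h : qform (fun w => f w + g w) h = qform f h + qform g h.
Proof. by rewrite /qform -big_split; apply: eq_bigr => z _; rewrite mulrDl. Qed.

Lemma qformZl c f h : qform (fun w => c * f w) h = c * qform f h.
Proof. by rewrite /qform mulr_sumr; apply: eq_bigr => z _; rewrite mulrA. Qed.

Lemma qformDr f g h : qform h (fun w => f w + g w) = qform h f + qform h g.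
Proof. by rewrite !(qformC h) qformDl. Qed.

Lemma qformZr c f h : qform h (fun w => c * f w) = c * qform h f.
Proof. by rewrite !(qformC h) qformZl. Qed.

Definition qformE := (qformDl, qformDr, qformZl, qformZr).

Lemma mdeg_ge0 f z : (forall w, 0 <= f w) -> 0 <= mdeg f z.
Proof. by move=> f0; apply: sumr_ge0 => w _; rewrite mulr_ge0 ?adjr_ge0. Qed.

Lemma mdeg_le_mass f z : (forall w, 0 <= f w) -> mdeg f z <= mass f.
Proof.
move=> f0; apply: ler_sum => w _; rewrite -[leRHS]mul1r.
exact: ler_wpM2r (adjr_le1 z w).
Qed.

Lemma qform_ge0 f g :
  (forall w, 0 <= f w) -> (forall w, 0 <= g w) -> 0 <= qform f g.
Proof.
by move=> f0 g0; apply: sumr_ge0 => z _; rewrite mulr_ge0 ?mdeg_ge0.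
Qed.

Lemma ind_ge0 (A : {set G}) z : 0 <= ind A z.
Proof. exact: ler0n. Qed.

Lemma mass_ind (A : {set G}) : mass (ind A) = #|A|%:R.
Proof.
by rewrite /mass /ind -natr_sum -big_mkcond sum1_card.
Qed.

Definition nbr z : {set G} := [set w | adj z w].

Lemma mdeg_nbr f z : mdeg f z = mass (fun w => ind (nbr z) w * f w).
Proof. by apply: eq_bigr => w _; rewrite /ind inE. Qed.

Lemma qform_independent (A : {set G}) f g :
    (forall z w, z \in A -> w \in A -> ~~ adj z w) ->
    (forall z, z \notin A -> f z = 0) -> (forall z, z \notin A -> g z = 0) ->
  qform f g = 0.
Proof.
move=> indA f0 g0; apply: big1 => z _.
case: (boolP (z \in A)) => [zA|/f0 ->]; last by rewrite mul0r.
rewrite [mdeg _ _]big1 ?mulr0 // => w _.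
case: (boolP (w \in A)) => [wA|/g0 ->]; last by rewrite mulr0.
by rewrite /adjr (negPf (indA _ _ zA wA)) mul0r.
Qed.

Hypothesis tfG : triangle_free G.

Lemma nbr_independent v z w : z \in nbr v -> w \in nbr v -> ~~ adj z w.
Proof.
rewrite !inE => vz vw; apply/negP=> zw; have := tfG v z w.
by rewrite vz zw adj_sym vw.
Qed.

Lemma nbr_disjoint z w v : adj z w -> v \in nbr z -> v \notin nbr w.
Proof.
rewrite !inE => zw zv; apply/negP=> wv; have := tfG z w v.
by rewrite zw wv adj_sym zv.
Qed.

Lemma mdeg_edge f z w : (forall v, 0 <= f v) -> adj z w ->
  mdeg f z + mdeg f w <= mass f.
Proof.
move=> f0 zw; rewrite -big_split; apply: ler_sum => v _ /=.
rewrite -mulrDl -[leRHS]mul1r; apply: ler_wpM2r => //.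
have := @nbr_disjoint _ _ v zw; rewrite !inE /adjr.
by case: (adj z v) => [/(_ isT)/negPf->|_] /=; [|case: (adj w v) => /=]; lra.
Qed.

(** Weighting each edge by the degree sum of its ends, which [mdeg_edge] bounds by the mass,
    produces twice the second moment of the degrees. Besides implying [mantel], the estimate forces
    all degrees to be half the mass when [mantel] is tight. *)
Lemma mantel_sum f : (forall v, 0 <= f v) ->
  \sum_z f z * (mdeg f z - mass f / 2) ^+ 2 <=
    mass f / 2 * (mass f ^+ 2 / 2 - qform f f).
Proof.
move=> f0.
have le2 : 2 * (\sum_z f z * mdeg f z ^+ 2) <= mass f * qform f f.
  have -> : 2 * (\sum_z f z * mdeg f z ^+ 2) =
      \sum_z \sum_w adjr z w * f z * f w * (mdeg f z + mdeg f w).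
    transitivity (\sum_z \sum_w (adjr z w * f z * f w * mdeg f z)
                + \sum_z \sum_w (adjr z w * f z * f w * mdeg f w)).
      rewrite [X in _ + X]exchange_big mulrDl mul1r; congr (_ + _).
        apply: eq_bigr => z _; rewrite expr2 mulrA {1}/mdeg mulr_sumr mulr_suml.
        by apply: eq_bigr => w _; ring.
      apply: eq_bigr => z _; rewrite expr2 mulrA {1}/mdeg mulr_sumr mulr_suml.
      by apply: eq_bigr => w _; rewrite adjrC; ring.
    rewrite -big_split; apply: eq_bigr => z _; rewrite -big_split.
    by apply: eq_bigr => w _ /=; ring.
  rewrite /qform mulr_sumr; apply: ler_sum => z _.
  rewrite [X in _ <= _ * X]mulr_sumr mulr_sumr; apply: ler_sum => w _.
  have [zw|nzw] := boolP (adj z w); last by rewrite /adjr (negPf nzw) !(mul0r, mulr0).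
  rewrite [leRHS](_ : _ = adjr z w * f z * f w * mass f); last by ring.
  by apply: ler_wpM2l (mdeg_edge f0 zw); rewrite !mulr_ge0 ?adjr_ge0.
suff -> : \sum_z f z * (mdeg f z - mass f / 2) ^+ 2 =
    (\sum_z f z * mdeg f z ^+ 2) - mass f * qform f f + mass f ^+ 3 / 4 by lra.
rewrite /qform mulr_sumr -sumrB.
have -> : mass f ^+ 3 / 4 = \sum_z f z * (mass f ^+ 2 / 4).
  by rewrite -mulr_suml -/(mass f); field.
by rewrite -big_split; apply: eq_bigr => z _ /=; field.
Qed.

Lemma mantel f : (forall v, 0 <= f v) -> qform f f <= mass f ^+ 2 / 2.
Proof.
move=> f0; have mf0 : 0 <= mass f by apply: sumr_ge0.
have := mantel_sum f0.
have : 0 <= \sum_z f z * (mdeg f z - mass f / 2) ^+ 2.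
  by apply: sumr_ge0 => z _; rewrite mulr_ge0 ?sqr_ge0.
(* The factor [mass f / 2] cannot be cancelled when it is 0; the trivial bound by the squared mass
   then suffices. *)
have [mf00|mf_neq0] := eqVneq (mass f) 0; last first.
  move=> ge0 /(le_trans ge0); rewrite pmulr_rge0 ?subr_ge0 //.
  by rewrite divr_gt0 // lt0r mf_neq0.
have : qform f f <= mass f * mass f.
  rewrite {2}/mass mulr_sumr; apply: ler_sum => z _; rewrite mulrC.
  by apply: ler_wpM2r => //; apply: mdeg_le_mass.
by rewrite mf00; lra.
Qed.

End Form.

(** * Rounding fractional colourings *)

Section Pipage.
Variables (G : sgraph) (R : realFieldType).
Implicit Types (x y h : G -> 'I_3 -> R) (u v w z : G) (i j k l : 'I_3).

Definition fcost x : R := (\sum_k qform (x^~ k) (x^~ k)) / 2.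

Definition feasible (m : R) x :=
  [/\ forall z k, 0 <= x z k, forall z, \sum_k x z k = 1
    & forall k, mass (x^~ k) = m].

Definition supp x := [set p : G * 'I_3 | x p.1 p.2 != 0].

Lemma fcost_line x h (t : R) :
  fcost (fun z k => x z k + t * h z k) =
    fcost x + t * (\sum_k qform (x^~ k) (h^~ k)) + t ^+ 2 * fcost h.
Proof.
have E : \sum_k qform (fun z => x z k + t * h z k) (fun z => x z k + t * h z k)
    = \sum_k qform (x^~ k) (x^~ k) + t * (\sum_k qform (x^~ k) (h^~ k)) * 2
    + t ^+ 2 * (\sum_k qform (h^~ k) (h^~ k)).
  rewrite !mulr_sumr mulr_suml -!big_split; apply: eq_bigr => k _ /=.
  by rewrite !qformE (qformC (h^~ k) (x^~ k)); ring.
by rewrite /fcost E; field.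
Qed.

Lemma fcost_opp h : fcost (fun z k => - h z k) = fcost h.
Proof.
congr (_ / 2); apply: eq_bigr => k _.
rewrite (@eq_qform _ _ _ (fun w => -1 * h w k) _ (fun w => -1 * h w k)).
- by rewrite !qformE; ring.
- by move=> w; ring.
- by move=> w; ring.
Qed.

Lemma pipage_step_down m x h z0 k0 :
    feasible m x -> (forall z, \sum_k h z k = 0) ->
    (forall k, mass (h^~ k) = 0) -> (forall z k, x z k = 0 -> h z k = 0) ->
    h z0 k0 != 0 -> \sum_k qform (x^~ k) (h^~ k) <= 0 -> fcost h <= 0 ->
  exists x', [/\ feasible m x', fcost x' <= fcost x, supp x' \proper supp x
    & fcost h < 0 -> fcost x' < fcost x].
Proof.
move=> [x0 x1 xm] hk hz xh h0 L0 C0.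
have [k1 hk1] : exists k, h z0 k < 0.
  apply/existsP; apply: contraNT h0; rewrite negb_exists => /forallP hge0.
  have {}hge0 k : 0 <= h z0 k by rewrite leNgt; apply: hge0.
  have /eqP := hk z0; rewrite psumr_eq0 => [/allP hz0|k _]; last exact: hge0.
  exact: hz0 (mem_index_enum k0).
(* The step length is the smallest ratio over the decreasing entries: no entry becomes negative and
   the minimising one vanishes, so the support shrinks. *)
pose P (p : G * 'I_3) := h p.1 p.2 < 0.
pose F (p : G * 'I_3) := x p.1 p.2 / - h p.1 p.2.
have P0 : P (z0, k1) by [].
case: (arg_minP F P0) => -[z1 k2] /=; rewrite /P /= => hneg minF.
have x1gt0 : 0 < x z1 k2.
  rewrite lt0r x0 andbT; apply: contraTneq hneg => /xh ->; rewrite ltxx //.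
pose t := F (z1, k2).
have t_gt0 : 0 < t by rewrite divr_gt0 // oppr_gt0.
exists (fun z k => x z k + t * h z k); split.
- split=> [z k|z|k].
  + have [hge0|hlt0] := leP 0 (h z k).
      by rewrite addr_ge0 // mulr_ge0 // ltW.
    have := minF (z, k) hlt0; rewrite -/t /F /= ler_pdivlMr ?oppr_gt0 //.
    by rewrite mulrN; lra.
  + by rewrite big_split /= -mulr_sumr hk x1 mulr0 addr0.
  + by rewrite massD massZ hz xm mulr0 addr0.
- rewrite fcost_line; have := mulr_ge0_le0 (ltW t_gt0) L0.
  by have := mulr_ge0_le0 (sqr_ge0 t) C0; lra.
- apply/properP; split.
    apply/subsetP=> -[z k]; rewrite !inE /=; apply: contraNneq => xz.
    by rewrite xz xh // mulr0 addr0.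
  exists (z1, k2); rewrite !inE /=; first by rewrite gt_eqF.
  by rewrite negbK /t /F /=; apply/eqP; field; rewrite lt_eqF.
- move=> C1; rewrite fcost_line; have := mulr_ge0_le0 (ltW t_gt0) L0.
  have : t ^+ 2 * fcost h < 0 by rewrite pmulr_rlt0 ?exprn_gt0.
  lra.
Qed.

(* [fcost] is quadratic along [h] with leading coefficient [fcost h <= 0], so it
   does not increase in one of the directions [h] and [- h]. *)
Lemma pipage_step m x h z0 k0 :
    feasible m x -> (forall z, \sum_k h z k = 0) ->
    (forall k, mass (h^~ k) = 0) -> (forall z k, x z k = 0 -> h z k = 0) ->
    h z0 k0 != 0 -> fcost h <= 0 ->
  exists x', [/\ feasible m x', fcost x' <= fcost x, supp x' \proper supp x
    & fcost h < 0 -> fcost x' < fcost x].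
Proof.
move=> fx hk hz xh h0 C0.
have [L0|L0] := leP (\sum_k qform (x^~ k) (h^~ k)) 0.
  exact: (@pipage_step_down m x h z0 k0).
rewrite -(fcost_opp h).
apply: (pipage_step_down (h := fun z k => - h z k) (z0 := z0) (k0 := k0)) => //.
- by move=> z; rewrite sumrN hk oppr0.
- by move=> k; rewrite /mass sumrN -/(mass _) hz oppr0.
- by move=> z k /xh ->; rewrite oppr0.
- by rewrite oppr_eq0.
- rewrite (eq_bigr (fun k => -1 * qform (x^~ k) (h^~ k))) => [|k _].
    by rewrite -mulr_sumr; lra.
  by rewrite -qformZr; apply: eq_qform => w //; rewrite mulN1r.
- by rewrite fcost_opp.
Qed.

Definition unitv (i k : 'I_3) : R := (k == i)%:R.
Definition dirac v z : R := (z == v)%:R.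

Lemma sum_unitv i (F : 'I_3 -> R) : \sum_k unitv i k * F k = F i.
Proof.
rewrite (bigD1 i) //= /unitv eqxx mul1r big1 ?addr0 // => k /negPf ->.
exact: mul0r.
Qed.

Lemma sum_unitvB i j (F : 'I_3 -> R) :
  \sum_k (unitv j k - unitv i k) * F k = F j - F i.
Proof.
under eq_bigr => k _ do rewrite mulrBl.
by rewrite sumrB !sum_unitv.
Qed.

Lemma mass_dirac v : mass (dirac v) = 1.
Proof.
by rewrite /mass (bigD1 v) //= /dirac eqxx big1 ?addr0 // => z /negPf ->.
Qed.

Lemma qform_dirac v w : qform (dirac v) (dirac w) = adjr R v w.
Proof.
rewrite /qform (bigD1 v) //= {1}/dirac eqxx mul1r [X in _ + X]big1 => [|z]; last first.
  by move/negPf => zv; rewrite /dirac zv mul0r.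
rewrite addr0 /mdeg (bigD1 w) //= {1}/dirac eqxx mulr1 big1 ?addr0 // => z.
by move/negPf => zw; rewrite /dirac zw mulr0.
Qed.

Lemma adjr_irrefl v : adjr R v v = 0.
Proof. by rewrite /adjr adj_irrefl. Qed.

(* The exchange direction sending an amount of colour from [i1] to [j1] at
   [v1], from [i2] to [j2] at [v2] and from [i3] to [j3] at [v3]. *)
Definition dir3 v1 i1 j1 v2 i2 j2 v3 i3 j3 z k : R :=
  (unitv j1 k - unitv i1 k) * dirac v1 z +
  ((unitv j2 k - unitv i2 k) * dirac v2 z +
   (unitv j3 k - unitv i3 k) * dirac v3 z).

Lemma dir3_colour v1 i1 j1 v2 i2 j2 v3 i3 j3 z :
  \sum_k dir3 v1 i1 j1 v2 i2 j2 v3 i3 j3 z k = 0.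
Proof. by rewrite !big_split /= !sum_unitvB; ring. Qed.

Lemma mass_dir3 v1 i1 j1 v2 i2 j2 v3 i3 j3 k :
  mass ((dir3 v1 i1 j1 v2 i2 j2 v3 i3 j3)^~ k) =
  (unitv j1 k - unitv i1 k) + (unitv j2 k - unitv i2 k) +
  (unitv j3 k - unitv i3 k).
Proof. by rewrite /dir3 !massD !massZ !mass_dirac; ring. Qed.

(** A single move has no self-interaction because adjacency is irreflexive; two moves contribute the
    adjacency of their vertices times the inner product of their colour changes. *)
Lemma fcost_dir3 v1 i1 j1 v2 i2 j2 v3 i3 j3 :
  fcost (dir3 v1 i1 j1 v2 i2 j2 v3 i3 j3) =
  adjr R v1 v2 * ((unitv j2 j1 - unitv i2 j1) - (unitv j2 i1 - unitv i2 i1)) +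
  adjr R v1 v3 * ((unitv j3 j1 - unitv i3 j1) - (unitv j3 i1 - unitv i3 i1)) +
  adjr R v2 v3 * ((unitv j3 j2 - unitv i3 j2) - (unitv j3 i2 - unitv i3 i2)).
Proof.
have dotE i j i' j' : (unitv j' j - unitv i' j) - (unitv j' i - unitv i' i) =
    \sum_k (unitv j k - unitv i k) * (unitv j' k - unitv i' k).
  by rewrite (sum_unitvB i j (fun k => unitv j' k - unitv i' k)).
rewrite !dotE !mulr_sumr -!big_split /fcost mulr_suml.
apply: eq_bigr => k _; rewrite /dir3 !qformE !qform_dirac !adjr_irrefl.
by rewrite (adjrC R v2 v1) (adjrC R v3 v1) (adjrC R v3 v2) /=; field.
Qed.

(** The alternative [i3 = j3] admits a void third move, so that exchanges between two vertices are
    also instances of [dir3]. *)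
Lemma dir3_supp x v1 i1 j1 v2 i2 j2 v3 i3 j3 z k :
    0 < x v1 i1 -> 0 < x v1 j1 -> 0 < x v2 i2 -> 0 < x v2 j2 ->
    (i3 = j3) \/ (0 < x v3 i3) && (0 < x v3 j3) ->
  x z k = 0 -> dir3 v1 i1 j1 v2 i2 j2 v3 i3 j3 z k = 0.
Proof.
have aux v i j : (i = j) \/ (0 < x v i) && (0 < x v j) -> x z k = 0 ->
    (unitv j k - unitv i k) * dirac v z = 0.
  case=> [->|/andP[vi vj]] xzk; first by rewrite subrr mul0r.
  rewrite /unitv /dirac; case: (eqVneq z v) => [zv|]; last by rewrite mulr0.
  rewrite -zv in vi vj *.
  case: (eqVneq k j) => [kj|_]; first by rewrite -kj xzk ltxx in vj.
  case: (eqVneq k i) => [ki|_]; first by rewrite -ki xzk ltxx in vi.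
  by rewrite subrr mul0r.
move=> vi1 vj1 vi2 vj2 vij3 xzk; rewrite /dir3 !aux ?addr0 //; right.
  by rewrite vi2.
by rewrite vi1.
Qed.

(** Opposite colour changes have inner product -2, so an edge between [v] and [w] makes the cost
    strictly concave in this direction. *)
Lemma pipage_exchange m x v w i j :
    feasible m x -> v != w -> i != j ->
    0 < x v i -> 0 < x v j -> 0 < x w i -> 0 < x w j ->
  exists x', [/\ feasible m x', fcost x' <= fcost x, supp x' \proper supp x
    & adj v w -> fcost x' < fcost x].
Proof.
move=> fx vw ij vi vj wi wj.
have hcost : fcost (dir3 v i j w j i v i i) = - 2 * adjr R v w.
  rewrite fcost_dir3 /unitv !eqxx (negPf ij) eq_sym (negPf ij) /=; lra.
have [] := @pipage_step m x (dir3 v i j w j i v i i) v i fx.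
- exact: dir3_colour.
- by move=> k; rewrite mass_dir3; ring.
- by move=> z k; apply: dir3_supp => //; left.
- rewrite /dir3 /unitv /dirac !eqxx (negPf vw) (negPf ij) /=.
  by rewrite mulr0 mulr1 subrr mul0r !addr0 sub0r oppr_eq0 oner_eq0.
- by rewrite hcost; have := adjr_ge0 R v w; lra.
move=> x' [fx' le_c px' lt_c]; exists x'; split=> // vw_adj.
by apply: lt_c; rewrite hcost /adjr vw_adj /=; lra.
Qed.

(** Any two of the three colour changes have inner product -1, so the direction has nonpositive cost
    whatever the adjacencies. *)
Lemma pipage_cycle m x u v w i j l :
    feasible m x -> u != v -> u != w -> v != w -> i != j -> j != l -> l != i ->
    0 < x u i -> 0 < x u j -> 0 < x v j -> 0 < x v l -> 0 < x w l ->
    0 < x w i ->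
  exists x', [/\ feasible m x', fcost x' <= fcost x & supp x' \proper supp x].
Proof.
move=> fx uv uw vw ij jl li ui uj vj vl wl wi.
have [] := @pipage_step m x (dir3 u i j v j l w l i) u i fx.
- exact: dir3_colour.
- by move=> k; rewrite mass_dir3; ring.
- by move=> z k; apply: dir3_supp => //; right; rewrite wl.
- rewrite /dir3 /unitv /dirac !eqxx (negPf uv) (negPf uw) (negPf ij) /=.
  by rewrite !mulr0 !addr0 mulr1 sub0r oppr_eq0 oner_eq0.
- have ji := ij; rewrite eq_sym in ji; have lj := jl; rewrite eq_sym in lj.
  have il := li; rewrite eq_sym in il.
  rewrite fcost_dir3 /unitv !eqxx.
  rewrite !(negPf ij, negPf jl, negPf li, negPf ji, negPf lj, negPf il) /=.
  have := adjr_ge0 R u v; have := adjr_ge0 R u w; have := adjr_ge0 R v w; lra.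
by move=> x' [fx' le_c px' _]; exists x'.
Qed.

Definition fractional x z k := (0 < x z k) && (x z k < 1).

Lemma feasible_le1 m x z k : feasible m x -> x z k <= 1.
Proof.
by case=> x0 x1 _; rewrite -(x1 z) (bigD1 k) //= lerDl; apply: sumr_ge0.
Qed.

Lemma fractional_colour m x z i : feasible m x -> fractional x z i ->
  exists2 j, i != j & fractional x z j.
Proof.
move=> fx /andP[zi zi1]; have [x0 x1 _] := fx.
have [j ij zj] : exists2 j, i != j & 0 < x z j.
  apply/exists_inP; apply: contraTT zi1; rewrite negb_exists_in => /forall_inP nz.
  rewrite -leNgt -(x1 z) (bigD1 i) //= big1 ?addr0 // => j ji.
  by apply/eqP; rewrite eq_le x0 andbT leNgt; apply: nz; rewrite eq_sym.
exists j; rewrite // /fractional zj /= -(x1 z) (bigD1 j) //= ltrDl.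
by rewrite (bigD1 i) //= ltr_pwDl // sumr_ge0.
Qed.

(** A colour class has integral mass. With a single fractional entry, [m] would lie strictly between
    consecutive integers. *)
Lemma fractional_vertex (m : nat) x z i : feasible m%:R x -> fractional x z i ->
  exists2 w, z != w & fractional x w i.
Proof.
move=> fx /andP[zi zi1]; have [x0 _ xm] := fx.
apply/exists_inP; apply: contraTT isT; rewrite negb_exists_in => /forall_inP nf.
have int w : z != w -> x w i = (x w i == 1)%:R.
  move=> /nf; rewrite /fractional lt_neqAle x0 andbT eq_sym negb_and negbK.
  have := feasible_le1 w i fx; rewrite le_eqVlt.
  by case/orP=> [/eqP->|->]; rewrite ?eqxx ?oner_eq0 ?orbF // => /eqP ->;
    rewrite eq_sym oner_eq0.
have := xm i; rewrite /mass (bigD1 z) //=.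
under eq_bigr => w wz do rewrite (int w) 1?eq_sym //.
rewrite -natr_sum; set c := (\sum_(w | _) _)%N => cm.
have : (c%:R : R) < m%:R by rewrite -cm; lra.
have : (m%:R : R) < c.+1%:R by rewrite -cm -natr1; lra.
by rewrite !ltr_nat ltnS => mc /leq_trans/(_ mc); rewrite ltnn.
Qed.

Lemma ord3_third i j k l :
  i != j -> i != k -> j != k -> j != l -> l != i -> l = k.
Proof.
move=> + + + + + ; rewrite -!val_eqE /= => ij ik jk jl li; apply/val_inj => /=.
by have := ltn_ord i; have := ltn_ord j; have := ltn_ord k;
   have := ltn_ord l; lia.
Qed.

(* The fractional entries form a bipartite graph of minimum degree 2 between
   vertices and colours; with three colours it has a cycle of length 4 or 6. *)
Lemma pipage (m : nat) x : feasible m%:R x ->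
  exists y, [/\ feasible m%:R y, fcost y <= fcost x
    & forall z k, ~~ fractional y z k].
Proof.
have [N] := ubnP #|supp x|; elim: N x => // N IHN x; rewrite ltnS => leN fx.
have [/existsP[z /existsP[i zi]]|] := boolP [exists z, exists i, fractional x z i];
  last first.
  move=> nfr; exists x; split=> // z k; apply: contraNN nfr => zk.
  by apply/existsP; exists z; apply/existsP; exists k.
suff [x' [fx' cx' sx']] :
    exists x', [/\ feasible m%:R x', fcost x' <= fcost x & supp x' \proper supp x].
  have [|y [fy cy nfy]] := IHN x' _ fx'.
    exact: leq_trans (proper_card sx') leN.
  by exists y; split=> //; apply: le_trans cy cx'.
have ex v w i' j' : v != w -> i' != j' -> fractional x v i' -> fractional x v j' ->
    fractional x w i' -> fractional x w j' ->
    exists x', [/\ feasible m%:R x', fcost x' <= fcost x & supp x' \proper supp x].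
  move=> vw ij /andP[vi _] /andP[vj _] /andP[wi _] /andP[wj _].
  have [x' [fx' cx' sx' _]] := pipage_exchange fx vw ij vi vj wi wj.
  by exists x'.
have [j ij zj] := fractional_colour fx zi.
have [z1 zz1 z1i] := fractional_vertex fx zi.
have [j1 ij1 z1j1] := fractional_colour fx z1i.
have [jj1|jj1] := eqVneq j j1.
  by apply: (ex z z1 i j) => //; rewrite jj1.
have [z2 zz2 z2j] := fractional_vertex fx zj.
have [z12|z12] := eqVneq z1 z2.
  by apply: (ex z z1 i j) => //; rewrite z12.
have [l jl z2l] := fractional_colour fx z2j.
have [li|li] := eqVneq l i.
  by apply: (ex z z2 i j) => //; rewrite -li.
have lj1 : l = j1 by apply: ord3_third ij ij1 jj1 jl li.
rewrite eq_sym in z12; rewrite -lj1 in z1j1.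
move: zi zj z2j z2l z1i z1j1 => /andP[zi _] /andP[zj _] /andP[z2j _] /andP[z2l _].
move=> /andP[z1i _] /andP[z1l _].
exact: (pipage_cycle fx zz2 zz1 z12 ij jl li zi zj z2j z2l z1l z1i).
Qed.

End Pipage.

(** * From fractional colourings back to balanced partitions *)

Section Bridge.
Variables (G : sgraph) (R : realFieldType).
Implicit Types (A : {set G}) (x : G -> 'I_3 -> R).

(** Each edge is the image of exactly two ordered pairs, its orientations. *)
Lemma card_arcs A :
  #|[set p : G * G | [&& p.1 \in A, p.2 \in A & adj p.1 p.2]]|
    = (2 * num_edges A)%N.
Proof.
set S := [set p | _]; pose f (p : G * G) := [set p.1; p.2].
have imS : f @: S = [set E in edges G | E \subset A].
  apply/setP=> E; rewrite !inE; apply/imsetP/andP.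
    case=> -[z w]; rewrite inE /= => /and3P[zA wA zw] ->; split.
      by apply/imsetP; exists (z, w); rewrite ?inE.
    by rewrite /f /= subUset !sub1set zA.
  case=> /imsetP[[z w]]; rewrite inE /= => zw ->.
  by rewrite subUset !sub1set => /andP[zA wA]; exists (z, w); rewrite // inE zA wA.
rewrite -sum1_card (partition_big_imset f) /= imS /num_edges mulnC -sum_nat_const.
apply: eq_bigr => E; rewrite -imS => /imsetP[[z w]].
rewrite inE /= => /and3P[zA wA zw] ->.
have zNw : z != w by apply: contraTneq zw => ->; rewrite adj_irrefl.
rewrite sum1_card (_ : 2 = #|[set (z, w); (w, z)]|)%N; last first.
  by rewrite cards2 xpair_eqE negb_and zNw.
apply: eq_card => -[z' w']; rewrite !inE /= !xpair_eqE /f /=.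
apply/andP/orP; last first.
  case=> /andP[/eqP -> /eqP ->]; rewrite inE /= zA wA ?zw ?eqxx //.
  by rewrite adj_sym zw setUC eqxx.
case; rewrite inE /= => /and3P[_ _ z'w'] /eqP eqE.
have z'Nw' : z' != w' by apply: contraTneq z'w' => ->; rewrite adj_irrefl.
have : z' \in [set z; w] by rewrite -eqE !inE eqxx.
have : w' \in [set z; w] by rewrite -eqE !inE eqxx orbT.
rewrite !inE => /orP[] /eqP ew /orP[] /eqP ez; move: z'Nw'; rewrite ew ez ?eqxx //.
- by right.
- by left.
Qed.

Lemma qform_ind A : qform (ind R A) (ind R A) = 2 * (num_edges A)%:R.
Proof.
rewrite -natrM -card_arcs /qform /mdeg.
under eq_bigr => z _ do rewrite mulr_sumr.
rewrite pair_big /= -sum1_card natr_sum [RHS]big_mkcond.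
apply: eq_bigr => -[z w] _ /=; rewrite /ind /adjr inE /=.
by case: (z \in A); case: (w \in A); case: (adj z w); rewrite /= ?(mulr0, mul0r, mulr1).
Qed.

Lemma Dbal_le_integral (m : nat) x :
  feasible m%:R x -> (forall z k, ~~ fractional x z k) ->
  (Dbal 3 G)%:R <= fcost x.
Proof.
move=> fx nfr; have [x0 x1 xm] := fx.
pose A := [ffun k : 'I_3 => [set z | x z k == 1]].
have xE z k : x z k = ind R (A k) z.
  rewrite /ind ffunE inE; have := nfr z k; rewrite /fractional lt_neqAle x0 andbT.
  rewrite negb_and -leNgt negbK => /orP[/eqP <-|le1].
    by rewrite eq_sym oner_eq0.
  have -> : x z k = 1 by apply/eqP; rewrite eq_le le1 (feasible_le1 z k fx).
  by rewrite eqxx.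
have balA : balanced_partition A.
  apply/and3P; split.
  - rewrite -subTset; apply/subsetP=> z _; apply/bigcupP.
    have : \sum_k x z k != 0 by rewrite x1 oner_neq0.
    case: (pickP (fun k => z \in A k)) => [k zk _|nz]; first by exists k.
    by rewrite big1 ?eqxx // => k _; rewrite xE /ind nz.
  - apply/forallP=> i; apply/forallP=> j; apply/implyP=> ij.
    rewrite -setI_eq0; apply/eqP/setP=> z; rewrite !inE; apply/negP=> /andP[zi zj].
    have := x1 z; rewrite (bigD1 i) //= (bigD1 j) 1?eq_sym //=.
    rewrite !xE /ind zi zj /= => /eqP.
    have : 0 <= \sum_(k | (k != i) && (k != j)) x z k by apply: sumr_ge0.
    by move=> s0 /eqP; lra.
  - apply/forallP=> i; apply/forallP=> j; rewrite -(eqr_nat R) -!mass_ind.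
    by rewrite -!(eq_mass (xE^~ _)) !xm.
have [_ /(_ A balA)] := @Dbal_min 3 G (ex_intro _ A balA).
rewrite -(ler_nat R) => /le_trans; apply.
rewrite /partition_cost /fcost natr_sum mulr_suml; apply: ler_sum => k _.
by rewrite (eq_qform (xE^~ k) (xE^~ k)) qform_ind; lra.
Qed.

Lemma Dbal_le_fcost (m : nat) x : feasible m%:R x -> (Dbal 3 G)%:R <= fcost x.
Proof.
case/pipage=> y [fy cy nfr]; apply: le_trans cy.
exact: Dbal_le_integral fy nfr.
Qed.

(** One exchange already lowers the cost strictly, and rounding its result does not raise it again.
    Strictness in [sparse_lt] and [one_independent_lt] comes from here. *)
Lemma Dbal_lt_fcost (m : nat) x v w i j :
    feasible m%:R x -> adj v w -> i != j ->
    0 < x v i -> 0 < x v j -> 0 < x w i -> 0 < x w j ->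
  (Dbal 3 G)%:R < fcost x.
Proof.
move=> fx vw ij vi vj wi wj.
have vNw : v != w by apply: contraTneq vw => ->; rewrite adj_irrefl.
have [y [fy _ _ /(_ vw)]] := pipage_exchange fx vNw ij vi vj wi wj.
by apply: le_lt_trans; apply: Dbal_le_fcost fy.
Qed.

End Bridge.

(** * Cheap fractional bisections *)

Section Bisection.
Variables (G : sgraph) (R : realFieldType).
Variable mu : G -> R.
Hypothesis mu_ge0 : forall z, 0 <= mu z.
Implicit Types (f g : G -> R) (z w v : G).

Let r := mass mu.
Let Q := qform mu mu.

(** Only pairs where [f] takes opposite signs contribute negatively. They are handled by the
    arithmetic-geometric mean inequality with parameter [t = 2 s / r], and the masses of the two
    sign classes have product at most [s^2 / 4]. *)
Lemma qform_lower f : 0 < r ->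
  - (Q / r + r / 8) * mass (fun z => mu z * f z ^+ 2) <=
    qform (fun z => mu z * f z) (fun z => mu z * f z).
Proof.
move=> r_gt0; set s := mass _; set F := qform _ _.
have s0 : 0 <= s by apply: sumr_ge0 => z _; rewrite mulr_ge0 ?sqr_ge0.
pose P z := if 0 < f z then mu z * f z ^+ 2 else 0.
pose N z := if 0 < f z then 0 else mu z * f z ^+ 2.
have P0 z : 0 <= P z by rewrite /P; case: ifP => // _; rewrite mulr_ge0 ?sqr_ge0.
have N0 z : 0 <= N z by rewrite /N; case: ifP => // _; rewrite mulr_ge0 ?sqr_ge0.
have PN : mass P + mass N = s.
  by rewrite -massD; apply: eq_mass => z; rewrite /P /N; case: ifP => _;
     rewrite ?addr0 ?add0r.
pose t := 2 * s / r.
have t0 : 0 <= t by rewrite divr_ge0 ?mulr_ge0 // ltW.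
(* Where [f z * f w < 0], use [- 2 t f z f w <= t^2 + (f z f w)^2]. *)
have bound : - (2 * t) * F <= t ^+ 2 * Q + 2 * (mass P * mass N).
  have -> : 2 * (mass P * mass N) = \sum_z \sum_w (P z * N w + N z * P w).
    under eq_bigr => z _ do rewrite big_split /= -!mulr_sumr.
    by rewrite big_split /= -!mulr_suml /mass; ring.
  rewrite /F /Q /qform !mulr_sumr -big_split; apply: ler_sum => z _ /=.
  rewrite /mdeg !mulr_sumr -big_split; apply: ler_sum => w _ /=.
  have PN0 : 0 <= P z * N w + N z * P w.
    by rewrite addr_ge0 ?mulr_ge0.
  have [zw|zw] := boolP (adj z w); last first.
    by rewrite /adjr (negPf zw) /= !(mul0r, mulr0) add0r.
  rewrite /adjr zw /= !mul1r.
  have m0 : 0 <= mu z * mu w by rewrite mulr_ge0.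
  rewrite [leLHS](_ : _ = mu z * mu w * (- (2 * t) * (f z * f w))); last by ring.
  have [/andP[fz fw]|nPP] := boolP ((0 < f z) && (0 < f w)).
    apply: le_trans (_ : 0 <= _).
      apply: mulr_ge0_le0 => //; apply: mulr_le0_ge0; first by lra.
      by rewrite mulr_ge0 ?ltW.
    by rewrite addr_ge0 // mulr_ge0 ?sqr_ge0.
  have [/andP[fz fw]|nNN] := boolP ((f z <= 0) && (f w <= 0)).
    apply: le_trans (_ : 0 <= _).
      apply: mulr_ge0_le0 => //; apply: mulr_le0_ge0; first by lra.
      by rewrite mulr_le0.
    by rewrite addr_ge0 // mulr_ge0 ?sqr_ge0.
  have -> : P z * N w + N z * P w = mu z * mu w * (f z * f w) ^+ 2.
    move: nPP nNN; rewrite /P /N !leNgt.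
    by case: (0 < f z); case: (0 < f w) => //= _ _; ring.
  rewrite (_ : t ^+ 2 * _ = mu z * mu w * t ^+ 2); last by ring.
  rewrite -mulrDr; apply: ler_wpM2l => //.
  have := sqr_ge0 (t + f z * f w); rewrite sqrrD; lra.
have PN4 : mass P * mass N <= s ^+ 2 / 4.
  have := sqr_ge0 (mass P - mass N); rewrite -PN sqrrB sqrrD; lra.
have [s00|s_neq0] := eqVneq s 0.
  have f00 z : mu z * f z = 0.
    have /eqP := s00; rewrite /s /mass psumr_eq0 => [/allP/(_ z)|w _].
      rewrite mem_index_enum => /(_ isT) /=; rewrite mulf_eq0 sqrf_eq0.
      by case/orP=> /eqP->; rewrite ?(mul0r, mulr0).
    by rewrite mulr_ge0 ?sqr_ge0.
  rewrite s00 mulr0 /F /qform big1 // => z _.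
  by rewrite f00 mul0r.
have t_gt0 : 0 < t by rewrite divr_gt0 // mulr_gt0 // lt0r s_neq0.
rewrite -(ler_pM2l t_gt0).
have -> : t * (- (Q / r + r / 8) * s) = - (t ^+ 2 * Q + s ^+ 2 / 2) / 2.
  by rewrite /t; field; rewrite gt_eqF.
by lra.
Qed.

Definition nbr_part v z := if adj v z then mu z else 0.
Definition far_part v z := if adj v z then 0 else mu z.

Lemma nbr_partE v z : nbr_part v z + far_part v z = mu z.
Proof. by rewrite /nbr_part /far_part; case: ifP; rewrite ?addr0 ?add0r. Qed.

Lemma mass_nbr_part v : mass (nbr_part v) = mdeg mu v.
Proof.
apply: eq_bigr => w _; rewrite /nbr_part /adjr.
by case: (adj v w); rewrite ?mul1r ?mul0r.
Qed.

Lemma mass_far_part v : mass (far_part v) = r - mdeg mu v.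
Proof.
apply/eqP; rewrite eq_sym subr_eq -mass_nbr_part addrC -massD; apply/eqP.
by apply: eq_mass => z; rewrite nbr_partE.
Qed.

Hypothesis tfG : triangle_free G.

Lemma qform_nbr_part v : qform (nbr_part v) (nbr_part v) = 0.
Proof.
by apply: (@qform_independent _ _ (nbr v)) => [z w|z|z];
   [exact: nbr_independent | rewrite inE /nbr_part => /negPf -> ..].
Qed.

Let mud z := mu z * mdeg mu z.

Lemma qform_nbr_far v : qform (nbr_part v) (far_part v) = mdeg mud v.
Proof.
have : qform (nbr_part v) (nbr_part v) + qform (nbr_part v) (far_part v)
       = mdeg mud v.
  rewrite -qformDr (@eq_qform _ _ _ (nbr_part v) _ mu) => // [|z].
    apply: eq_bigr => w _; rewrite /nbr_part /adjr /mud.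
    by case: (adj v w); rewrite ?(mul0r, mul1r).
  exact: nbr_partE.
by rewrite qform_nbr_part add0r.
Qed.

Lemma qform_far v : qform (far_part v) (far_part v) = Q - 2 * mdeg mud v.
Proof.
have -> : Q = qform (fun z => nbr_part v z + far_part v z)
                    (fun z => nbr_part v z + far_part v z).
  by apply: eq_qform => z; rewrite nbr_partE.
rewrite !qformE qform_nbr_part (qformC (far_part v) (nbr_part v)).
by rewrite qform_nbr_far; ring.
Qed.

(* The average over [v], weighted by [mu], of the slack when the first part is
   [N(v)] completed by a constant fraction of the remaining mass. *)
Lemma nbr_bisection_average : 0 < r ->
  0 <= \sum_v mu v * ((r - mdeg mu v) ^+ 2 * r ^+ 2 / 8 -
    ((r ^+ 2 / 2 - r * mdeg mu v + mdeg mu v ^+ 2) * Q -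
      r * mdeg mu v * mdeg mud v)).
Proof.
move=> r_gt0; pose D2 := mass (fun z => mu z * mdeg mu z ^+ 2).
pose W3 := qform mud mud.
have -> : \sum_v mu v * ((r - mdeg mu v) ^+ 2 * r ^+ 2 / 8 -
    ((r ^+ 2 / 2 - r * mdeg mu v + mdeg mu v ^+ 2) * Q -
      r * mdeg mu v * mdeg mud v)) =
    (r ^+ 4 / 8 - r ^+ 2 / 2 * Q) * r + (r * Q - r ^+ 3 / 4) * Q
    + (r ^+ 2 / 8 - Q) * D2 + r * W3.
  rewrite (eq_bigr (fun v => (r ^+ 4 / 8 - r ^+ 2 / 2 * Q) * mu v +
    (r * Q - r ^+ 3 / 4) * (mu v * mdeg mu v) +
    (r ^+ 2 / 8 - Q) * (mu v * mdeg mu v ^+ 2) +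
    r * (mud v * mdeg mud v))) => [|v _]; last by rewrite /mud; field.
  by rewrite !big_split /= -!mulr_sumr.
(* Centring the degrees at their [mu]-average [Q / r] makes the terms in [D2] cancel; what remains
   is the square [r / 8 (r^2 - 3 Q)^2]. *)
pose d := Q / r.
have := @qform_lower (fun z => mdeg mu z - d) r_gt0.
have -> : mass (fun z => mu z * (mdeg mu z - d) ^+ 2) =
    D2 - 2 * d * Q + d ^+ 2 * r.
  rewrite /mass (eq_bigr (fun v => mu v * mdeg mu v ^+ 2 +
    (- (2 * d) * (mu v * mdeg mu v) + d ^+ 2 * mu v))) => [|v _]; last by ring.
  by rewrite !big_split /= -!mulr_sumr /D2 /Q /qform /r /mass; ring.
have -> : qform (fun z => mu z * (mdeg mu z - d)) (fun z => mu z * (mdeg mu z - d))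
    = W3 - 2 * d * D2 + d ^+ 2 * Q.
  have E z : mu z * (mdeg mu z - d) = mud z + (- d) * mu z by rewrite /mud; ring.
  rewrite (eq_qform E E) !qformE -/W3 (qformC mu mud).
  have -> : qform mud mu = D2.
    by apply: eq_bigr => z _; rewrite /mud; ring.
  by rewrite -/Q; ring.
rewrite /d -(ler_pM2l r_gt0) => low.
have : 0 <= r / 8 * (r ^+ 2 - 3 * Q) ^+ 2.
  by rewrite mulr_ge0 ?sqr_ge0 // divr_ge0 // ltW.
have e1 : r * (- (Q / r + r / 8) * (D2 - 2 * (Q / r) * Q + (Q / r) ^+ 2 * r)) =
   - (Q + r ^+ 2 / 8) * D2 + (Q ^+ 3 / r + r * Q ^+ 2 / 8).
  by field; rewrite gt_eqF.
have e2 : r * (W3 - 2 * (Q / r) * D2 + (Q / r) ^+ 2 * Q) =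
  r * W3 - 2 * Q * D2 + Q ^+ 3 / r by field; rewrite gt_eqF.
by rewrite e1 e2 in low; lra.
Qed.

(** The share [p] of the far part completes N(v) to mass [r / 2]. After clearing the denominator,
    the slack is the averaged quantity above, so it is nonnegative for some [v]. *)
Lemma nbr_bisection : 0 < r -> (forall v, mdeg mu v <= r / 2) ->
  exists v, let p := (r / 2 - mdeg mu v) / (r - mdeg mu v) in
    qform (fun z => nbr_part v z + p * far_part v z)
          (fun z => nbr_part v z + p * far_part v z) +
    qform (fun z => (1 - p) * far_part v z) (fun z => (1 - p) * far_part v z)
      <= r ^+ 2 / 8.
Proof.
move=> r_gt0 degr.
have [v hv] : exists v, ((r ^+ 2 / 2 - r * mdeg mu v + mdeg mu v ^+ 2) * Q -
      r * mdeg mu v * mdeg mud v) <= (r - mdeg mu v) ^+ 2 * r ^+ 2 / 8.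
  apply/existsP; apply: contraT; rewrite negb_exists => /forallP nle.
  have := nbr_bisection_average r_gt0; rewrite leNgt => /negP[].
  have [v v_gt0] : exists v, 0 < mu v.
    apply/existsP; apply: contraTT r_gt0; rewrite negb_exists => /forallP npos.
    rewrite /r /mass big1 ?ltxx // => z _; apply/eqP.
    by rewrite eq_le mu_ge0 leNgt npos.
  rewrite (bigD1 v) //= -[ltRHS]addr0; apply: ltr_leD; last apply: sumr_le0 => w _.
    by rewrite pmulr_rlt0 // subr_lt0 ltNge.
  by rewrite mulr_ge0_le0 // subr_le0 ltW // ltNge.
exists v => p; have rd : 0 < r - mdeg mu v by have := degr v; lra.
rewrite !qformE (qformC (far_part v) (nbr_part v)) qform_nbr_part qform_nbr_far.
rewrite qform_far -(ler_pM2l (exprn_gt0 2 rd)); set c := (X in _ * X <= _).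
have -> : (r - mdeg mu v) ^+ 2 * c =
  (r ^+ 2 / 2 - r * mdeg mu v + mdeg mu v ^+ 2) * Q - r * mdeg mu v * mdeg mud v.
  by rewrite /c /p; field; rewrite gt_eqF.
by rewrite mulrA.
Qed.

Lemma mass_ge0 f : (forall z, 0 <= f z) -> 0 <= mass f.
Proof. by move=> f0; apply: sumr_ge0. Qed.

Lemma nbr_part_ge0 v z : 0 <= nbr_part v z.
Proof. by rewrite /nbr_part; case: ifP. Qed.

Lemma far_part_ge0 v z : 0 <= far_part v z.
Proof. by rewrite /far_part; case: ifP. Qed.

(** If some neighbourhood carries more than half of the mass, a half placed inside it costs nothing
    and Mantel's theorem bounds the other half by [r^2 / 8]. Otherwise [nbr_bisection] applies. *)
Lemma bisection : exists f g : G -> R,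
  [/\ forall z, 0 <= f z, forall z, 0 <= g z, forall z, f z + g z = mu z,
      mass f = r / 2 & mass g = r / 2] /\
  qform f f + qform g g <= r ^+ 2 / 8.
Proof.
have r0 : 0 <= r by apply: mass_ge0.
have [r00|r_neq0] := eqVneq r 0.
  exists mu, (fun=> 0); split; first split=> //.
  - by move=> z; rewrite addr0.
  - by rewrite -/r r00; lra.
  - by rewrite r00 /mass big1 //; lra.
  rewrite [X in _ + X]big1 => [|z _]; last by rewrite mul0r.
  by have := mantel tfG mu_ge0; rewrite -/r r00; lra.
have r_gt0 : 0 < r by rewrite lt0r r_neq0.
have [/forallP degr|] := boolP [forall v, mdeg mu v <= r / 2].
  have [v /=] := nbr_bisection r_gt0 degr.
  set p := (_ / _) => cost.
  have dv := degr v; have rd : 0 < r - mdeg mu v by lra.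
  have p0 : 0 <= p by apply: divr_ge0; lra.
  have p1 : p <= 1 by rewrite ler_pdivrMr //; lra.
  do 2![eexists]; split; last exact: cost.
  split=> [z|z|z||].
  - by rewrite addr_ge0 ?nbr_part_ge0 // mulr_ge0 ?far_part_ge0.
  - by rewrite mulr_ge0 ?far_part_ge0 // subr_ge0.
  - by rewrite -(nbr_partE v z); ring.
  - by rewrite massD massZ mass_nbr_part mass_far_part /p; field; rewrite gt_eqF.
  - by rewrite massZ mass_far_part /p; field; rewrite gt_eqF.
rewrite negb_forall => /existsP[v]; rewrite -ltNge => dv.
pose p := (r / 2) / mdeg mu v.
have d_gt0 : 0 < mdeg mu v by lra.
have p0 : 0 <= p by apply: divr_ge0; lra.
have p1 : p <= 1 by rewrite ler_pdivrMr // mul1r ltW.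
have g0 z : 0 <= (1 - p) * nbr_part v z + far_part v z.
  by rewrite addr_ge0 ?far_part_ge0 // mulr_ge0 ?nbr_part_ge0 // subr_ge0.
have mg : mass (fun z => (1 - p) * nbr_part v z + far_part v z) = r / 2.
  by rewrite massD massZ mass_nbr_part mass_far_part /p; field; rewrite gt_eqF.
exists (fun z => p * nbr_part v z),
       (fun z => (1 - p) * nbr_part v z + far_part v z); split; first split=> //.
- by move=> z; rewrite mulr_ge0 ?nbr_part_ge0.
- by move=> z; rewrite -(nbr_partE v z); ring.
- by rewrite massZ mass_nbr_part /p; field; rewrite gt_eqF.
have := mantel tfG g0; rewrite mg !qformZl !qformZr qform_nbr_part; lra.
Qed.

End Bisection.

(** * Perron vectors *)

Section Spectral.
Import ComplexField.Normc.
Local Open Scope sesquilinear_scope.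

Lemma mulmx_conj_row (C : numClosedFieldType) n (w : 'rV[C]_n) :
  (w *m w ^t*) 0 0 = \sum_j `|w 0 j| ^+ 2.
Proof. by rewrite mxE; apply: eq_bigr => j _; rewrite !mxE normCK. Qed.

(** In an orthonormal eigenbasis the ratio of the squared norms of [o *m A] and [o] is a weighted
    average of squared moduli of eigenvalues, so some eigenvalue reaches it. *)
Lemma dominant_eigenvector (C : numClosedFieldType) n (A : 'M[C]_n) (o : 'rV[C]_n) :
    A \is normalmx -> o != 0 ->
  exists (y : 'rV[C]_n) (l : C), [/\ y != 0, y *m A = l *: y &
    \sum_j `|(o *m A) 0 j| ^+ 2 <= `|l| ^+ 2 * \sum_j `|o 0 j| ^+ 2].
Proof.
move=> /orthomx_spectralP; set P := spectralmx A; set D := spectral_diag A => eA o0.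
have Pu : P \is unitarymx := spectral_unitarymx A.
have PP : P *m P ^t* = 1%:M by apply/unitarymxP.
have PA : P *m A = diag_mx D *m P.
  by rewrite {1}eA !mulmxA mulmxV ?spectral_unit // mul1mx.
have oE : o *m A = o *m P ^t* *m diag_mx D *m P.
  by rewrite {1}eA (invmx_unitary Pu) !mulmxA.
pose c := o *m P ^t*.
have normA : \sum_j `|(o *m A) 0 j| ^+ 2 = \sum_i `|c 0 i| ^+ 2 * `|D 0 i| ^+ 2.
  rewrite -mulmx_conj_row oE -/c [in X in _ *m X]trmx_mul [in X in _ *m X]map_mxM.
  rewrite mulmxA -(mulmxA (c *m diag_mx D)) PP mulmx1.
  rewrite mulmx_conj_row; apply: eq_bigr => i _.
  by rewrite mul_mx_diag mxE normrM exprMn.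
have normo : \sum_j `|o 0 j| ^+ 2 = \sum_i `|c 0 i| ^+ 2.
  rewrite -[RHS]mulmx_conj_row /c [in RHS]trmx_mul [in RHS]map_mxM trmxCK mulmxA.
  by rewrite -(mulmxA o) (mulmx1C PP) mulmx1 mulmx_conj_row.
have S0 : 0 < \sum_j `|o 0 j| ^+ 2.
  have [j oj] : exists j, o 0 j != 0.
    apply/existsP; apply: contraNT o0; rewrite negb_exists => /forallP oj.
    by apply/eqP/rowP=> j; rewrite mxE; apply/eqP; have := oj j; rewrite negbK.
  rewrite (bigD1 j) //= ltr_pwDl ?exprn_gt0 ?normr_gt0 //.
  by apply: sumr_ge0 => i _; rewrite exprn_ge0.
have [i hi] : exists i, \sum_j `|(o *m A) 0 j| ^+ 2 <=
    `|D 0 i| ^+ 2 * \sum_j `|o 0 j| ^+ 2.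
  apply/existsP; apply: contraT; rewrite negb_exists => /forallP nle.
  have lt i : `|D 0 i| ^+ 2 * (\sum_j `|o 0 j| ^+ 2) < \sum_j `|(o *m A) 0 j| ^+ 2.
    rewrite real_ltNge ?nle //.
      by rewrite ger0_real // mulr_ge0 ?exprn_ge0 // ltW.
    by rewrite ger0_real // sumr_ge0 // => j _; rewrite exprn_ge0.
  set S := \sum_j `|o 0 j| ^+ 2 in S0 normo lt *.
  set T := \sum_j `|(o *m A) 0 j| ^+ 2 in normA lt *.
  have [i ci] : exists i, c 0 i != 0.
    apply/existsP; apply: contraTT S0; rewrite negb_exists => /forallP c0.
    rewrite normo big1 ?ltxx // => i _; have := c0 i; rewrite negbK => /eqP ->.
    by rewrite normr0 expr0n.
  have : T * S < T * S.
    rewrite {1}normA {2}normo mulr_suml mulr_sumr (bigD1 i) //= [ltRHS](bigD1 i) //=.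
    have le k : `|c 0 k| ^+ 2 * `|D 0 k| ^+ 2 * S <= T * `|c 0 k| ^+ 2.
      by rewrite mulrC [leRHS]mulrC mulrCA ler_wpM2l ?exprn_ge0 // mulrC ltW.
    apply: ltr_leD; last by apply: ler_sum => k _.
    rewrite mulrC [ltRHS]mulrC mulrCA ltr_pM2l ?exprn_gt0 ?normr_gt0 //.
    by rewrite mulrC.
  by rewrite ltxx.
exists (row i P), (D 0 i); split=> //.
- apply: contra_neq (oner_neq0 C) => rP0.
  have /matrixP/(_ i i) := PP; rewrite !mxE eqxx mulr1n => <-.
  rewrite big1 // => j _; have /rowP/(_ j) := rP0; rewrite !mxE => ->.
  by rewrite mul0r.
- by rewrite -row_mul PA row_mul row_diag_mx -scalemxAl -rowE.
Qed.

Section Perron.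
Variables (G : sgraph) (R : rcfType).

(* [xi] is the vector of moduli of a complex eigenvector of the adjacency matrix
   for an eigenvalue of largest modulus, scaled to have maximum 1. *)
Lemma perron_vector : (0 < #|G|)%N ->
  exists (xi : G -> R) (u : G) (l : R),
    [/\ forall z, 0 <= xi z <= 1, xi u = 1, 0 <= l,
        forall z, l * xi z <= mdeg xi z &
        \sum_z mdeg (fun _ : G => 1) z ^+ 2 <= #|G|%:R * l ^+ 2].
Proof.
move=> G_gt0; pose n := #|G|; pose C : numClosedFieldType := R[i].
pose A : 'M[C]_n := \matrix_(i, j) (adj (enum_val i) (enum_val j))%:R.
have Anormal : A \is normalmx.
  apply/normalmxP; suff -> : A ^t* = A by [].
  by apply/matrixP=> i j; rewrite !mxE adj_sym conjC_nat.
(* The all-ones vector is the test vector: its image has the degrees as entries, which yields the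
   last clause. *)
have o0 : (const_mx 1 : 'rV[C]_n) != 0.
  apply/eqP=> /rowP/(_ (Ordinal G_gt0)); rewrite !mxE => /eqP.
  by rewrite oner_eq0.
have [y [l [y0 yA hS]]] := dominant_eigenvector Anormal o0.
have nE (x : C) : `|x| = (normc x)%:C%C by [].
have n0 (x : C) : 0 <= normc x by case: x => a b; apply: sqrtr_ge0.
pose xi0 (z : G) := normc (y 0 (enum_rank z)).
have adjC i w : A i (enum_rank w) = (adjr R (enum_val i) w)%:C%C.
  by rewrite mxE enum_rankK /adjr; case: (adj _ _).
(* The triangle inequality turns the eigenvalue equation into an inequality for the moduli. *)
have le_xi0 w : normc l * xi0 w <= mdeg xi0 w.
  rewrite -lecR rmorphM /= -!nE -normrM.
  have /rowP/(_ (enum_rank w)) := yA; rewrite !mxE => <-.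
  apply: le_trans (ler_norm_sum _ _ _) _; rewrite /mdeg rmorph_sum /=.
  rewrite (reindex (@enum_rank G)) /=; last exact: onW_bij (enum_rank_bij G).
  apply: ler_sum => z _; rewrite normrM adjC enum_rankK rmorphM /= -nE mulrC.
  by rewrite adjrC ger0_norm // ler0c adjr_ge0.
have [u0 _] : exists u0 : G, u0 \in G by apply/card_gt0P.
case: (@Order.TotalTheory.arg_maxP _ _ G u0 predT xi0 isT) => u _ umax.
have M_gt0 : 0 < xi0 u.
  rewrite lt0r n0 andbT; apply: contra_neq y0 => xu0; apply/rowP=> j.
  rewrite mxE; apply/eqP; rewrite -normr_eq0 nE.
  have := umax (enum_val j) isT; rewrite /xi0 enum_valK -/(xi0 u) xu0 => le0.
  by rewrite (_ : normc _ = 0) //; apply/eqP; rewrite eq_le n0 andbT; apply: le0.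
exists (fun z => (xi0 u)^-1 * xi0 z), u, (normc l); split=> [z||//|z|].
- rewrite mulr_ge0 ?invr_ge0 ?n0 //= mulrC ler_pdivrMr // mul1r.
  exact: umax.
- by rewrite mulVf ?gt_eqF.
- by rewrite mdegZ mulrCA ler_wpM2l ?invr_ge0 ?n0.
have := hS; rewrite -lecR.
have -> : \sum_j `|(const_mx 1 : 'rV[C]_n) 0 j| ^+ 2 = (#|G|%:R : C).
  rewrite (eq_bigr (fun=> 1)) => [|j _]; last by rewrite mxE normr1 expr1n.
  by rewrite sumr_const card_ord.
have -> : \sum_j `|((const_mx 1 : 'rV[C]_n) *m A) 0 j| ^+ 2 =
    (\sum_z mdeg (fun _ : G => 1) z ^+ 2)%:C%C.
  rewrite (reindex (@enum_rank G)) /=; last exact: onW_bij (enum_rank_bij G).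
  rewrite rmorph_sum; apply: eq_bigr => z _; rewrite rmorphXn /=; congr (_ ^+ 2).
  have -> : ((const_mx 1 : 'rV[C]_n) *m A) 0 (enum_rank z) =
      (mdeg (fun _ : G => 1) z)%:C%C.
    rewrite mxE (reindex (@enum_rank G)) /=; last exact: onW_bij (enum_rank_bij G).
    rewrite /mdeg rmorph_sum; apply: eq_bigr => w _ /=.
    by rewrite adjC enum_rankK mxE mul1r mulr1 adjrC.
  by rewrite ger0_norm // ler0c mdeg_ge0.
by rewrite nE -rmorphXn /= -(rmorph_nat (real_complex R)) -rmorphM mulrC.
Qed.

End Perron.

End Spectral.

(** * Positivity of polynomials on boxes *)

Section BinaryIntegers.
Variable R : realFieldType.

(* Coefficients are kept in [Z] because [int] is unary and too slow for
   [vm_compute]. *)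
Fixpoint Rpos (p : positive) : R :=
  match p with
  | xH => 1
  | xO p => 2 * Rpos p
  | xI p => 1 + 2 * Rpos p
  end.

Definition RZ (z : Z) : R :=
  match z with Z0 => 0 | Zpos p => Rpos p | Zneg p => - Rpos p end.

Lemma Rpos_gt0 p : 0 < Rpos p.
Proof. by elim: p => [p IH|p IH|] /=; lra. Qed.

Lemma Rpos_succ p : Rpos (Pos.succ p) = 1 + Rpos p.
Proof. by elim: p => [p IH|p IH|] /=; rewrite ?IH; ring. Qed.

Lemma RZ_succ z : RZ (Z.succ z) = RZ z + 1.
Proof.
case: z => [|p|p]; first by rewrite add0r.
  by rewrite /= Pos.add_1_r Rpos_succ addrC.
elim/Pos.peano_ind: p => [|p _]; first by rewrite /= addNr.
have -> : Z.succ (Zneg (Pos.succ p)) = Zneg p by lia.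
by rewrite /= Rpos_succ; ring.
Qed.

Lemma RZ_pred z : RZ (Z.pred z) = RZ z - 1.
Proof. by rewrite -{2}[z]Z.succ_pred RZ_succ; ring. Qed.

Lemma RZD x y : RZ (Z.add x y) = RZ x + RZ y.
Proof.
elim/Z.peano_ind: x => [|x IH|x IH]; first by rewrite add0r.
  by rewrite Z.add_succ_l !RZ_succ IH; ring.
by rewrite Z.add_pred_l !RZ_pred IH; ring.
Qed.

Lemma RZ_gt0 z : Z.ltb Z0 z -> 0 < RZ z.
Proof. by case: z => // p _; apply: Rpos_gt0. Qed.

End BinaryIntegers.

(* A list [c_0; ...; c_n] stands for the binary form
   sum_k c_k y0^(n-k) y1^k, whose coefficients lie in an additive type [T]. *)
Section Forms.
Variables (R : realFieldType) (T : Type) (addT : T -> T -> T).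
Variables (shape : T -> bool) (ev : T -> R) (pos : T -> bool).
Hypothesis shapeD : forall x y, shape x -> shape y -> shape (addT x y).
Hypothesis evD : forall x y, shape x -> shape y -> ev (addT x y) = ev x + ev y.
Hypothesis pos_gt0 : forall x, pos x -> 0 < ev x.

Fixpoint eval_form (y0 y1 : R) (s : seq T) : R :=
  if s is c :: q then ev c * y0 ^+ size q + y1 * eval_form y0 y1 q else 0.

(** One Horner step: the coefficients of c y0^n + (y0 + y1) h, with n the length of [h]. *)
Fixpoint mix (c : T) (h : seq T) : seq T :=
  if h is x :: h' then addT c x :: mix x h' else [:: c].

(** The substitution y1 := y0 + y1, by Horner's rule with additions only; it covers the half y0 <=
    y1 of a cell. *)
Fixpoint upper (s : seq T) : seq T :=
  if s is c :: q then mix c (upper q) else [::].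

(** Reversal swaps the variables, so this substitutes y0 := y0 + y1. *)
Definition lower (s : seq T) : seq T := rev (upper (rev s)).

Lemma size_mix c h : size (mix c h) = (size h).+1.
Proof. by elim: h c => //= x h IH c; rewrite IH. Qed.

Lemma size_upper s : size (upper s) = size s.
Proof. by elim: s => //= c q IH; rewrite size_mix IH. Qed.

Lemma shape_mix c h : shape c -> all shape h -> all shape (mix c h).
Proof.
elim: h c => [|x h IH] c /= sc; first by rewrite sc.
by case/andP=> sx sh; rewrite shapeD ?IH.
Qed.

Lemma shape_upper s : all shape s -> all shape (upper s).
Proof. by elim: s => //= c q IH /andP[sc sq]; rewrite shape_mix ?IH. Qed.

Lemma eval_mix y0 y1 c h : shape c -> all shape h ->
  eval_form y0 y1 (mix c h) =
  ev c * y0 ^+ size h + (y0 + y1) * eval_form y0 y1 h.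
Proof.
elim: h c => [|x h IH] c /= sc; first by rewrite !mulr0.
case/andP=> sx sh; rewrite size_mix IH // evD // exprS; ring.
Qed.

Lemma eval_upper y0 y1 s : all shape s ->
  eval_form y0 y1 (upper s) = eval_form y0 (y0 + y1) s.
Proof.
elim: s => //= c q IH /andP[sc sq].
by rewrite eval_mix ?shape_upper // size_upper IH.
Qed.

Lemma eval_rcons y0 y1 s c :
  eval_form y0 y1 (rcons s c) = y0 * eval_form y0 y1 s + ev c * y1 ^+ size s.
Proof.
elim: s => [|x s IH] /=; first by rewrite !(mulr0, addr0, add0r, expr0).
by rewrite IH size_rcons !exprS; ring.
Qed.

Lemma eval_rev y0 y1 s : eval_form y0 y1 (rev s) = eval_form y1 y0 s.
Proof.
elim: s => //= c s IH; rewrite rev_cons eval_rcons IH size_rev; ring.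
Qed.

Lemma eval_lower y0 y1 s : all shape s ->
  eval_form y0 y1 (lower s) = eval_form (y0 + y1) y1 s.
Proof.
by move=> ss; rewrite eval_rev eval_upper ?all_rev // eval_rev addrC.
Qed.

(** The length is tested because the empty form evaluates to 0. *)
Definition pos_form (s : seq T) := (0 < size s)%N && all pos s.

Lemma eval_form_gt0 y0 y1 s : 0 <= y0 -> 0 <= y1 -> 0 < y0 + y1 ->
  pos_form s -> 0 < eval_form y0 y1 s.
Proof.
move=> y00 y10 y01; elim: s => // c q IH /andP[_ /= /andP[pc pq]].
have c0 := pos_gt0 pc.
case: q IH pq => [_ _|x q IH pq]; first by rewrite expr0 mulr0 addr0 mulr1.
have {IH} q0 := IH pq; move: y00; rewrite le_eqVlt => /orP[/eqP y00|y0_gt0].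
  by rewrite ltr_wpDl ?mulr_gt0 //; [rewrite mulr_ge0 ?exprn_ge0 -?y00 // ltW|lra].
by rewrite ltr_pwDl ?mulr_gt0 ?exprn_gt0 // mulr_ge0 // ltW.
Qed.

Fixpoint zipadd (s t : seq T) : seq T :=
  match s, t with
  | x :: s', y :: t' => addT x y :: zipadd s' t'
  | _, _ => [::]
  end.

(** [zipadd] truncates to the shorter list; prescribing the length at every nesting level makes it a
    faithful sum. *)
Definition shape_form n (s : seq T) := (size s == n) && all shape s.

Lemma shape_zipadd n s t :
  shape_form n s -> shape_form n t -> shape_form n (zipadd s t).
Proof.
rewrite /shape_form; elim: s t n => [|x s IH] [|y t] [|n] //=.
rewrite !eqSS => /andP[ss /andP[sx sh]] /andP[st /andP[sy th]].
by rewrite shapeD //= IH ?ss ?sh ?st.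
Qed.

Lemma eval_zipadd n y0 y1 s t : shape_form n s -> shape_form n t ->
  eval_form y0 y1 (zipadd s t) = eval_form y0 y1 s + eval_form y0 y1 t.
Proof.
rewrite /shape_form; elim: s t n => [|x s IH] [|y t] [|n] //=.
  by rewrite addr0.
rewrite !eqSS => /andP[ss /andP[sx sh]] /andP[st /andP[sy th]].
have /andP[/eqP -> _] : shape_form n (zipadd s t).
  by apply: shape_zipadd; rewrite /shape_form ?ss ?st.
rewrite evD // (IH t n) ?ss ?sh ?st ?th //.
by rewrite (eqP ss) (eqP st); ring.
Qed.

Lemma shape_form_upper n s : shape_form n s -> shape_form n (upper s).
Proof. by case/andP=> ss sh; rewrite /shape_form size_upper ss shape_upper. Qed.

Lemma shape_form_lower n s : shape_form n s -> shape_form n (lower s).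
Proof.
case/andP=> ss sh; rewrite /shape_form /lower size_rev size_upper size_rev ss.
by rewrite all_rev shape_upper ?all_rev.
Qed.

End Forms.

Section TernaryForms.
Variable R : realFieldType.

Local Notation form1 := (seq Z).
Local Notation form2 := (seq form1).
Local Notation form3 := (seq form2).

Definition add1 := zipadd Z.add.
Definition add2 := zipadd add1.
Definition shape1 n : form1 -> bool := shape_form xpredT n.
Definition shape2 m n : form2 -> bool := shape_form (shape1 n) m.
Definition shape3 l m n : form3 -> bool := shape_form (shape2 m n) l.

Section Evaluation.
Variables (x0 x1 y0 y1 z0 z1 : R).
Definition eval1 : form1 -> R := eval_form (@RZ R) z0 z1.
Definition eval2 : form2 -> R := eval_form eval1 y0 y1.
Definition eval3 : form3 -> R := eval_form eval2 x0 x1.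
End Evaluation.

Definition pos3 : form3 -> bool := pos_form (pos_form (pos_form (Z.ltb Z0))).

Lemma eval1D n z0 z1 s t : shape1 n s -> shape1 n t ->
  eval1 z0 z1 (add1 s t) = eval1 z0 z1 s + eval1 z0 z1 t.
Proof. by apply: eval_zipadd => // x y _ _; apply: RZD. Qed.

Lemma shape1D n s t : shape1 n s -> shape1 n t -> shape1 n (add1 s t).
Proof. exact: shape_zipadd. Qed.

Lemma eval2D m n y0 y1 z0 z1 s t : shape2 m n s -> shape2 m n t ->
  eval2 y0 y1 z0 z1 (add2 s t) = eval2 y0 y1 z0 z1 s + eval2 y0 y1 z0 z1 t.
Proof. by apply: eval_zipadd => [x y|x y]; [apply: shape1D|apply: eval1D]. Qed.

Lemma shape2D m n s t : shape2 m n s -> shape2 m n t -> shape2 m n (add2 s t).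
Proof. by apply: shape_zipadd => x y; apply: shape1D. Qed.

Lemma pos3_gt0 x0 x1 y0 y1 z0 z1 p :
    0 <= x0 -> 0 <= x1 -> 0 < x0 + x1 -> 0 <= y0 -> 0 <= y1 -> 0 < y0 + y1 ->
    0 <= z0 -> 0 <= z1 -> 0 < z0 + z1 ->
  pos3 p -> 0 < eval3 x0 x1 y0 y1 z0 z1 p.
Proof.
move=> x00 x10 x01 y00 y10 y01 z00 z10 z01.
apply: eval_form_gt0 => // q; apply: eval_form_gt0 => // r.
by apply: eval_form_gt0 => // c; apply: RZ_gt0.
Qed.

Definition split_upper (k : nat) : form3 -> form3 :=
  match k with
  | 0 => upper add2
  | 1 => map (upper add1)
  | _ => map (map (upper Z.add))
  end.

Definition split_lower (k : nat) : form3 -> form3 :=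
  match k with
  | 0 => lower add2
  | 1 => map (lower add1)
  | _ => map (map (lower Z.add))
  end.

Lemma eq_eval_form T T' (ev : T -> R) (ev' : T' -> R) (f : T -> T') y0 y1 s P :
  all P s -> (forall c, P c -> ev' (f c) = ev c) ->
  eval_form ev' y0 y1 (map f s) = eval_form ev y0 y1 s.
Proof.
move=> + eq_ev; elim: s => //= c q IH /andP[Pc Pq].
by rewrite size_map eq_ev // IH.
Qed.

Lemma shape_map T T' (P : T -> bool) (P' : T' -> bool) (f : T -> T') n s :
  (forall c, P c -> P' (f c)) -> shape_form P n s -> shape_form P' n (map f s).
Proof.
move=> PP /andP[sn Ps]; rewrite /shape_form size_map sn all_map /=.
by apply: sub_all Ps => c; apply: PP.
Qed.

Lemma shape_split_upper k l m n p :
  shape3 l m n p -> shape3 l m n (split_upper k p).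
Proof.
case: k => [|[|k]]; first by apply: shape_form_upper; apply: shape2D.
  by apply: shape_map => q; apply: shape_form_upper; apply: shape1D.
by do 2!apply: shape_map => ?; apply: shape_form_upper.
Qed.

Lemma shape_split_lower k l m n p :
  shape3 l m n p -> shape3 l m n (split_lower k p).
Proof.
case: k => [|[|k]]; first by apply: shape_form_lower; apply: shape2D.
  by apply: shape_map => q; apply: shape_form_lower; apply: shape1D.
by do 2!apply: shape_map => ?; apply: shape_form_lower.
Qed.

Lemma eval_upper0 l m n x0 x1 y0 y1 z0 z1 p : shape3 l m n p ->
  eval3 x0 x1 y0 y1 z0 z1 (split_upper 0 p) = eval3 x0 (x0 + x1) y0 y1 z0 z1 p.
Proof.
case/andP=> _; apply: eval_upper; first exact: shape2D.
by move=> ? ?; apply: eval2D.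
Qed.

Lemma eval_lower0 l m n x0 x1 y0 y1 z0 z1 p : shape3 l m n p ->
  eval3 x0 x1 y0 y1 z0 z1 (split_lower 0 p) = eval3 (x0 + x1) x1 y0 y1 z0 z1 p.
Proof.
case/andP=> _; apply: eval_lower; first exact: shape2D.
by move=> ? ?; apply: eval2D.
Qed.

Lemma eval_upper1 l m n x0 x1 y0 y1 z0 z1 p : shape3 l m n p ->
  eval3 x0 x1 y0 y1 z0 z1 (split_upper 1 p) = eval3 x0 x1 y0 (y0 + y1) z0 z1 p.
Proof.
case/andP=> _ sp; apply: eq_eval_form sp _ => q /andP[_].
by apply: eval_upper => [? ?|? ?]; [apply: shape1D | apply: eval1D].
Qed.

Lemma eval_lower1 l m n x0 x1 y0 y1 z0 z1 p : shape3 l m n p ->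
  eval3 x0 x1 y0 y1 z0 z1 (split_lower 1 p) = eval3 x0 x1 (y0 + y1) y1 z0 z1 p.
Proof.
case/andP=> _ sp; apply: eq_eval_form sp _ => q /andP[_].
by apply: eval_lower => [? ?|? ?]; [apply: shape1D | apply: eval1D].
Qed.

Lemma eval_upper2 k l m n x0 x1 y0 y1 z0 z1 p : shape3 l m n p ->
  eval3 x0 x1 y0 y1 z0 z1 (split_upper k.+2 p) =
  eval3 x0 x1 y0 y1 z0 (z0 + z1) p.
Proof.
case/andP=> _ sp; apply: eq_eval_form sp _ => q /andP[_ sq].
apply: eq_eval_form sq _ => c /andP[_].
by apply: eval_upper => // ? ? _ _; apply: RZD.
Qed.

Lemma eval_lower2 k l m n x0 x1 y0 y1 z0 z1 p : shape3 l m n p ->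
  eval3 x0 x1 y0 y1 z0 z1 (split_lower k.+2 p) =
  eval3 x0 x1 y0 y1 (z0 + z1) z1 p.
Proof.
case/andP=> _ sp; apply: eq_eval_form sp _ => q /andP[_ sq].
apply: eq_eval_form sq _ => c /andP[_].
by apply: eval_lower => // ? ? _ _; apply: RZD.
Qed.

Definition rectangular (p : form3) : bool :=
  shape3 (size p) (size (head [::] p)) (size (head [::] (head [::] p))) p.

(* Successive mediant subdivision of the variables listed in [vs], until on
   each cell one of the forms has positive coefficients. *)
Fixpoint subdivide (vs : seq nat) (ps : seq form3) : bool :=
  has pos3 ps ||
  (if vs is k :: vs' then
     subdivide vs' (map (split_upper k) ps) &&
     subdivide vs' (map (split_lower k) ps)
   else false).

(** In the variable being split, a point with [x0 <= x1] has coordinates [(x0, x1 - x0)] in the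
    upper cell, any other [(x0 - x1, x1)] in the lower one; homogeneous coordinates need no
    rescaling. The list [ps] is a disjunction, so negated side conditions can appear in it as
    alternatives. *)
Lemma subdivide_sound vs ps x0 x1 y0 y1 z0 z1 :
    0 <= x0 -> 0 <= x1 -> 0 < x0 + x1 -> 0 <= y0 -> 0 <= y1 -> 0 < y0 + y1 ->
    0 <= z0 -> 0 <= z1 -> 0 < z0 + z1 ->
    all rectangular ps -> subdivide vs ps ->
  has (fun p => 0 < eval3 x0 x1 y0 y1 z0 z1 p) ps.
Proof.
move=> + + + + + + + + + rect_ps.
have {rect_ps} : forall p, p \in ps -> exists l m n, shape3 l m n p.
  by move=> p /(allP rect_ps); do 3![eexists]; eassumption.
elim: vs ps x0 x1 y0 y1 z0 z1 => [|k vs IH] ps x0 x1 y0 y1 z0 z1 shp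
  x00 x10 x01 y00 y10 y01 z00 z10 z01 /=.
  rewrite orbF => /hasP[p pps pp]; apply/hasP; exists p => //.
  exact: pos3_gt0.
case/orP=> [/hasP[p pps pp]|/andP[up low]].
  by apply/hasP; exists p => //; apply: pos3_gt0.
have shu p : p \in map (split_upper k) ps -> exists l m n, shape3 l m n p.
  case/mapP=> q /shp[l [m [n sq]]] ->; exists l, m, n.
  exact: shape_split_upper.
have shl p : p \in map (split_lower k) ps -> exists l m n, shape3 l m n p.
  case/mapP=> q /shp[l [m [n sq]]] ->; exists l, m, n.
  exact: shape_split_lower.
case: k up low shu shl => [|[|k]] up low shu shl.
- have [le01|lt10] := leP x0 x1.
    have := IH _ x0 (x1 - x0) y0 y1 z0 z1 shu x00 _ _ y00 y10 y01 z00 z10 z01 up.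
    rewrite subr_ge0 le01 addrC subrK => /(_ isT) H.
    have x1_gt0 : 0 < x1 by lra.
    have /hasP[_ /mapP[p pps ->] pp] := H x1_gt0; apply/hasP; exists p => //.
    have [l [m [n sp]]] := shp p pps.
    by rewrite (eval_upper0 _ _ _ _ _ _ sp) addrC subrK in pp.
  have := IH _ (x0 - x1) x1 y0 y1 z0 z1 shl _ x10 _ y00 y10 y01 z00 z10 z01 low.
  rewrite subr_ge0 (ltW lt10) subrK => /(_ isT) H.
  have x0_gt0 : 0 < x0 by lra.
  have /hasP[_ /mapP[p pps ->] pp] := H x0_gt0; apply/hasP; exists p => //.
  have [l [m [n sp]]] := shp p pps.
  by rewrite (eval_lower0 _ _ _ _ _ _ sp) subrK in pp.
- have [le01|lt10] := leP y0 y1.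
    have := IH _ x0 x1 y0 (y1 - y0) z0 z1 shu x00 x10 x01 y00 _ _ z00 z10 z01 up.
    rewrite subr_ge0 le01 addrC subrK => /(_ isT) H.
    have y1_gt0 : 0 < y1 by lra.
    have /hasP[_ /mapP[p pps ->] pp] := H y1_gt0; apply/hasP; exists p => //.
    have [l [m [n sp]]] := shp p pps.
    by rewrite (eval_upper1 _ _ _ _ _ _ sp) addrC subrK in pp.
  have := IH _ x0 x1 (y0 - y1) y1 z0 z1 shl x00 x10 x01 _ y10 _ z00 z10 z01 low.
  rewrite subr_ge0 (ltW lt10) subrK => /(_ isT) H.
  have y0_gt0 : 0 < y0 by lra.
  have /hasP[_ /mapP[p pps ->] pp] := H y0_gt0; apply/hasP; exists p => //.
  have [l [m [n sp]]] := shp p pps.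
  by rewrite (eval_lower1 _ _ _ _ _ _ sp) subrK in pp.
- have [le01|lt10] := leP z0 z1.
    have := IH _ x0 x1 y0 y1 z0 (z1 - z0) shu x00 x10 x01 y00 y10 y01 z00 _ _ up.
    rewrite subr_ge0 le01 addrC subrK => /(_ isT) H.
    have z1_gt0 : 0 < z1 by lra.
    have /hasP[_ /mapP[p pps ->] pp] := H z1_gt0; apply/hasP; exists p => //.
    have [l [m [n sp]]] := shp p pps.
    by rewrite (eval_upper2 _ _ _ _ _ _ _ sp) addrC subrK in pp.
  have := IH _ x0 x1 y0 y1 (z0 - z1) z1 shl x00 x10 x01 y00 y10 y01 _ z10 _ low.
  rewrite subr_ge0 (ltW lt10) subrK => /(_ isT) H.
  have z0_gt0 : 0 < z0 by lra.
  have /hasP[_ /mapP[p pps ->] pp] := H z0_gt0; apply/hasP; exists p => //.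
  have [l [m [n sp]]] := shp p pps.
  by rewrite (eval_lower2 _ _ _ _ _ _ _ sp) subrK in pp.
Qed.

End TernaryForms.

(** * The three certified polynomial inequalities *)

Section FormData.
Local Open Scope Z_scope.

(* [formA], [formB] and [formC] are [128 polyA], [256 polyB] and [128 polyC],
   homogenised in the coordinates used in [polyA_gt0], [polyB_gt0] and
   [polyC_gt0]; the other forms are the negated side conditions. *)
Definition formA : seq (seq (seq Z)) :=
  [:: [:: [:: 32; 88; 128]; [:: -40; 352; 752]; [:: -128; 1112; 1960]; [:: 192; 2112; 2640]; [:: 384; 1728; 1704]; [:: 128; 448; 392]];
   [:: [:: 252; 144; 180]; [:: 48; -648; 744]; [:: -1408; -2360; 1928]; [:: -1728; -1272; 3336]; [:: -384; 1056; 2880]; [:: 128; 736; 896]];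
   [:: [:: 724; 530; 166]; [:: 1950; 348; 198]; [:: 1104; -2862; -366]; [:: -896; -4900; -404]; [:: -960; -2544; 216]; [:: -192; -336; 216]];
   [:: [:: 543; 552; 153]; [:: 2158; 1940; 502]; [:: 3288; 2418; 570]; [:: 2408; 1252; 284]; [:: 864; 240; 96]; [:: 128; 16; 32]]].

Definition formB : seq (seq (seq Z)) :=
  [:: [:: [:: 16; 32; -128]; [:: -208; -32; -832]; [:: -464; 704; -1568]; [:: 640; 4160; -224]; [:: 2432; 7648; 2480]; [:: 2304; 6144; 2832]; [:: 768; 1920; 1008]];
   [:: [:: 408; 576; -336]; [:: 88; 704; -3056]; [:: -3296; -1216; -8288]; [:: -5376; 1104; -8352]; [:: -1472; 9488; -488]; [:: 2176; 11072; 4360]; [:: 1280; 4096; 2096]];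
   [:: [:: 1456; 1976; -92]; [:: 4100; 5800; -2980]; [:: 1068; 3264; -11556]; [:: -6848; -3568; -17168]; [:: -7680; -1488; -10260]; [:: -2176; 3904; -760]; [:: 256; 2432; 1024]];
   [:: [:: 1782; 2436; 366]; [:: 7290; 9912; 246]; [:: 10700; 14584; -3460]; [:: 5952; 8868; -8460]; [:: -128; 1856; -7520]; [:: -1024; 592; -2488]; [:: -128; 512; -80]];
   [:: [:: 721; 1010; 253]; [:: 3508; 4892; 1024]; [:: 6860; 9520; 1436]; [:: 6856; 9524; 652]; [:: 3680; 5248; -196]; [:: 1024; 1616; -200]; [:: 128; 256; -16]]].

Definition formB1 : seq (seq (seq Z)) :=
  [:: [:: [:: 2; 8]; [:: 8; 20]; [:: 8; 14]];
   [:: [:: -7; 11]; [:: -4; 32]; [:: 8; 26]];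
   [:: [:: -10; 2]; [:: -16; 8]; [:: -4; 8]]].

Definition formB2 : seq (seq (seq Z)) :=
  [:: [:: [:: 0]; [:: -2]];
   [:: [:: 1]; [:: 0]]].

Definition formC : seq (seq (seq Z)) :=
  [:: [:: [:: 160; 656; 936; 540; 108]; [:: 192; 672; 720; 216; 0]; [:: 128; 384; 256; -96; -72]; [:: 128; 512; 704; 384; 72]];
   [:: [:: 736; 3184; 4848; 3024; 648]; [:: 192; 864; 1152; 480; 72]; [:: -512; -2240; -3744; -2736; -648]; [:: 384; 1536; 2112; 1152; 216]];
   [:: [:: 1632; 7496; 12046; 7867; 1701]; [:: -32; 2160; 6276; 5542; 1506]; [:: -2336; -7584; -8408; -3592; -384]; [:: 224; 1280; 2328; 1640; 384]];
   [:: [:: 2192; 10048; 15978; 10129; 1991]; [:: 1344; 9616; 19620; 14802; 3406]; [:: -1696; -2528; 2520; 5128; 1728]; [:: 0; 1104; 3144; 2760; 704]];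
   [:: [:: 1446; 6253; 9213; 5108; 678]; [:: 1980; 10114; 16890; 10512; 1684]; [:: 432; 4392; 9712; 7264; 1440]; [:: 240; 1768; 3584; 2608; 528]];
   [:: [:: 290; 1093; 1249; 282; -172]; [:: 500; 2050; 2490; 572; -392]; [:: 240; 1192; 1632; 416; -288]; [:: 80; 408; 592; 208; -64]]].

Definition formC1 : seq (seq (seq Z)) :=
  [:: [:: [:: -1; 0]];
   [:: [:: 0; 1]]].

End FormData.

Section Positivity.
Variable R : realFieldType.

(* With [c = 1 - a] and [l = c * t], each polynomial is the defect of a
   combination of the hypotheses of [scalar_contradiction]. In [polyA] the
   inequalities [strategy_uniform] and [strategy_skew], with weights [2 s - 1] and
   [1 - s - 2 a b], and in [polyC] the inequalities [strategy_skew] and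
   [strategy_split], are combined so that [rho] cancels; [polyB] uses
   [strategy_uniform] alone. *)
Definition polyA (a b l c t : R) : R :=
  let s := a + b in
  (1 + s) * (1 + s + 2 * a * b) + 8 * b * l ^+ 2 + 8 * a * (t * l ^+ 2)
  - 12 * s * l + 2 * s * c * l * (1 - t) ^+ 2.

Definition polyB (a b l t : R) : R :=
  let s := a + b in
  (1 + s) ^+ 2 - 4 * ((1 + s) * (a * l ^+ 2 + b * (t * l ^+ 2)) +
    (1 + a ^+ 2 + b ^+ 2) * (3 / 2 * l - l ^+ 2 - t * l ^+ 2)).

Definition polyC (a b l c t : R) : R :=
  let s := a + b in
  let e := 3 / 2 * l - c * l * (1 - t) ^+ 2 / 4 in
  let Phi := s * e - b * l ^+ 2 - a * (t * l ^+ 2) in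
  (1 + b) * (1 + b + 3 * a) *
    ((1 + s) * (2 - (a ^+ 2 + b ^+ 2 + s ^+ 2)) - 8 * Phi) +
  (1 - 2 * s) * (1 + s) *
    ((1 + s) * (4 - (1 + b) ^+ 2) - 16 * a * (e - t * l ^+ 2)
     - 8 * (1 + b) * (e - l ^+ 2)).

(** The variable [u] is the slack in [b <= 1 - l t], which turns the region into a box; it is at
    most 3/4 because [l t >= 1 / 4]. The arguments of [eval3] are barycentric coordinates on the
    three intervals. *)
Lemma polyA_gt0 a t u : 0 <= a <= 1 / 2 -> 1 / 2 <= t <= 1 -> 0 <= u <= 3 / 4 ->
  0 < polyA a (1 - (1 - a) * t ^+ 2 - u) ((1 - a) * t) (1 - a) t.
Proof.
move=> /andP[a0 a1] /andP[t0 t1] /andP[u0 u1].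
have : has (fun p => 0 < eval3 (1 - 2 * a) (2 * a) (2 - 2 * t) (2 * t - 1)
    (1 - 4 / 3 * u) (4 / 3 * u) p) [:: formA].
  apply: (@subdivide_sound R (flatten (nseq 5 [:: 0; 2; 1]%N))); try lra.
    by [].
  by vm_compute.
rewrite has_seq1 (_ : eval3 _ _ _ _ _ _ _ = 
  128 * polyA a (1 - (1 - a) * t ^+ 2 - u) ((1 - a) * t) (1 - a) t); last first.
  by rewrite /eval3 /eval2 /eval1 /polyA /=; field.
by rewrite pmulr_rgt0.
Qed.

(** On each cell either [polyB] is positive or one of the two side conditions fails. *)
Lemma polyB_gt0 a t u : 0 <= a <= 1 / 2 -> 1 / 2 <= t <= 1 -> 0 <= u <= 3 / 4 ->
  let b := 1 - (1 - a) * t ^+ 2 - u in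
  1 / 2 <= (1 - a) * t -> 1 - a - b - 2 * a * b <= 0 ->
  0 < polyB a b ((1 - a) * t) t.
Proof.
move=> /andP[a0 a1] /andP[t0 t1] /andP[u0 u1] b lt X1.
have : has (fun p => 0 < eval3 (1 - 2 * a) (2 * a) (2 - 2 * t) (2 * t - 1)
    (1 - 4 / 3 * u) (4 / 3 * u) p) [:: formB; formB1; formB2].
  apply: (@subdivide_sound R (flatten (nseq 5 [:: 0; 2; 1]%N))); try lra.
    by [].
  by vm_compute.
case/hasP=> p; rewrite !inE => /or3P[] /eqP ->.
- rewrite (_ : eval3 _ _ _ _ _ _ _ = 256 * polyB a b ((1 - a) * t) t).
    by rewrite pmulr_rgt0.
  by rewrite /eval3 /eval2 /eval1 /polyB /b /=; field.
- rewrite (_ : eval3 _ _ _ _ _ _ _ = 8 * (1 - a - b - 2 * a * b)); first by lra.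
  by rewrite /eval3 /eval2 /eval1 /b /=; field.
- rewrite (_ : eval3 _ _ _ _ _ _ _ = 4 * (1 / 2 - (1 - a) * t)); first by lra.
  by rewrite /eval3 /eval2 /eval1 /=; field.
Qed.

(** Here [b] itself is a box coordinate, and [formC1] disposes of the cells beyond the line
    [a + b = 1 / 2]. *)
Lemma polyC_gt0 a b t : 0 <= a -> 0 <= b -> a + b <= 1 / 2 -> 1 / 2 <= t <= 1 ->
  0 < polyC a b ((1 - a) * t) (1 - a) t.
Proof.
move=> a0 b0 ab /andP[t0 t1].
have : has (fun p => 0 < eval3 (1 - 2 * a) (2 * a) (2 - 2 * t) (2 * t - 1)
    (1 - 2 * b) (2 * b) p) [:: formC; formC1].
  apply: (@subdivide_sound R (flatten (nseq 4 [:: 0; 1; 2]%N))); try lra.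
    by [].
  by vm_compute.
case/hasP=> p; rewrite !inE => /orP[] /eqP ->.
  rewrite (_ : eval3 _ _ _ _ _ _ _ =
      128 * polyC a b ((1 - a) * t) (1 - a) t); first by rewrite pmulr_rgt0.
  by rewrite /eval3 /eval2 /eval1 /polyC /=; field.
rewrite (_ : eval3 _ _ _ _ _ _ _ = 2 * (a + b - 1 / 2)); first by lra.
by rewrite /eval3 /eval2 /eval1 /=; field.
Qed.

End Positivity.

(** * The scalar inequalities *)

(** As [X1 <= 0], [rho] may be replaced by its lower bound in [cost1]. Then [e] has coefficient
    [1 + a^2 + b^2], while [SI] and [SJ] have the nonpositive coefficients [-(1 + b^2 - a - a b)]
    and [-(1 + a^2 - b - a b)], so the bounds on all three can be substituted. *)
Lemma region_many_missing (R : realFieldType) (a b s l t e SI SJ rho : R)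
    (hs : s = a + b) (a_ge0 : 0 <= a) (b_ge0 : 0 <= b)
    (SI_ge : l ^+ 2 <= SI) (SJ_ge : t * l ^+ 2 <= SJ)
    (Phi := s * e - b * SI - a * SJ) (X1 := 1 - s - 2 * a * b) :
    a <= 1 / 2 -> b <= 3 / 4 -> 0 < polyB a b l t -> X1 <= 0 ->
    e - SI - SJ <= rho -> e <= 3 / 2 * l ->
    (1 + s) ^+ 2 / 4 <= (1 + s) * Phi + X1 * rho ->
  False.
Proof.
move=> a_le b_le pB X1_le0 rho_ge e_le cost1.
have g1 : X1 * rho <= X1 * (e - SI - SJ) by apply: ler_wnM2l.
have g2 : (1 + a ^+ 2 + b ^+ 2) * e <= (1 + a ^+ 2 + b ^+ 2) * (3 / 2 * l).
  by apply: ler_wpM2l e_le; rewrite !addr_ge0 ?sqr_ge0.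
have ab : a * b <= 1 / 2 * b by apply: ler_wpM2r.
have ab' : a * b <= 3 / 4 * a by rewrite mulrC; apply: ler_wpM2r.
have k1 : 0 <= 1 + b ^+ 2 - a - a * b.
  by have := sqr_ge0 (b - 1 / 4); rewrite sqrrB; clear -ab a_le; lra.
have g3 : (1 + b ^+ 2 - a - a * b) * l ^+ 2 <= (1 + b ^+ 2 - a - a * b) * SI.
  exact: ler_wpM2l SI_ge.
have k2 : 0 <= 1 + a ^+ 2 - b - a * b.
  by have := sqr_ge0 (a - 3 / 8); rewrite sqrrB; clear -ab' b_le; lra.
have g4 : (1 + a ^+ 2 - b - a * b) * (t * l ^+ 2) <=
    (1 + a ^+ 2 - b - a * b) * SJ.
  exact: ler_wpM2l SJ_ge.
suff : 0 < 0 :> R by rewrite ltxx.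
by move: pB cost1 g1 g2 g3 g4; rewrite /polyB /Phi /X1 hs; clear; lra.
Qed.

(** The weights [k2] on [cost2] and [2 (1 - 2 s)] on [cost3] cancel [rho], and [Ke] is eight times
    the resulting coefficient of [e]. The upper bound on [e] contains [SI]; [KS] ensures that the
    coefficient of [SI] keeps its sign after the substitution. *)
Lemma region_few_missing (R : realFieldType) (a b c s l t e SI SJ rho : R)
    (hs : s = a + b) (a_ge0 : 0 <= a) (b_ge0 : 0 <= b)
    (t_le1 : t <= 1) (lE : l = c * t)
    (SI_ge : l ^+ 2 <= SI) (SJ_ge : t * l ^+ 2 <= SJ)
    (Phi := s * e - b * SI - a * SJ)
    (Y := a ^+ 2 + b ^+ 2 + s ^+ 2) :
    1 / 2 <= t -> s <= 1 / 2 -> (1 - t) * c <= 1 / 2 - a -> 1 / 2 <= c ->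
    0 < polyC a b l c t ->
    4 * e <= 6 * l - l * c + l * t ^+ 2 * c + 2 * (1 - t) * SI ->
    (1 + s) * (2 - Y) / 8 <= Phi + (1 - 2 * s) * rho ->
    (1 + s) ^+ 2 * (4 - (1 + b) ^+ 2) / 16 <=
      (1 + s) * (a * (e - SJ) + (1 + b) / 2 * (e - SI))
      - (1 + b) * (1 + b + 3 * a) / 2 * rho ->
  False.
Proof.
move=> t_ge s_le dc c_ge pC e_le' cost2 cost3.
pose k2 := (1 + b) * (1 + b + 3 * a).
pose k3 := (1 - 2 * s) * (1 + s).
have b1 : 0 <= 1 + b by rewrite addr_ge0.
have s0 : 0 <= s by rewrite hs addr_ge0.
have s1 : 0 <= 1 - 2 * s by clear -s_le; lra.
have k20 : 0 <= k2 by rewrite mulr_ge0 // addr_ge0 // mulr_ge0.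
have k30 : 0 <= k3 by rewrite mulr_ge0 // addr_ge0.
have as_le : a <= s by rewrite hs lerDl.
have dt0 : 0 <= 1 - t by rewrite subr_ge0.
have dt : 1 - t <= 1 - 2 * a.
  have : (1 - t) * (1 / 2) <= (1 - t) * c by apply: ler_wpM2l.
  by clear -dc; lra.
have g1 : k2 * ((1 + s) * (2 - Y) / 8) <= k2 * (Phi + (1 - 2 * s) * rho).
  exact: ler_wpM2l.
have s2 : 0 <= 2 * (1 - 2 * s) by rewrite mulr_ge0.
have g2 := ler_wpM2l s2 cost3.
pose Ke := 8 * k2 * s + k3 * (16 * a + 8 * (1 + b)).
have Ke0 : 0 <= Ke.
  by rewrite addr_ge0 ?mulr_ge0 // addr_ge0 ?mulr_ge0.
have g3 := ler_wpM2l Ke0 e_le'.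
have KS : Ke * (1 - t) / 2 <= 8 * k2 * b + 8 * k3 * (1 + b).
  have i1 : k2 * s * (1 - t) <= k2 * ((1 - 2 * s) / 2 + b).
    rewrite -mulrA; apply: ler_wpM2l => //.
    apply: le_trans (_ : 1 / 2 * (1 - t) <= _); first exact: ler_wpM2r.
    by clear -dt hs; lra.
  have i2 : k3 * (2 * a + 1 + b) * (1 - t) <= k3 * (1 + b).
    rewrite -mulrA; apply: ler_wpM2l => //.
    apply: le_trans (_ : 2 * (1 + b) * (1 - t) <= _).
      by apply: ler_wpM2r => //; clear -as_le s_le b_ge0; lra.
    have : (2 * (1 - t)) * (1 + b) <= 1 * (1 + b).
      by apply: ler_wpM2r => //; clear -t_ge; lra.
    by clear; lra.
  have i3 : (1 - 2 * s) * k2 <= (1 - 2 * s) * (2 * (1 + s) * (1 + b)).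
    apply: ler_wpM2l => //; rewrite /k2 [leRHS]mulrC.
    by apply: ler_wpM2l => //; clear -hs as_le s_le b_ge0; lra.
  have i4 : 0 <= k2 * b by rewrite mulr_ge0.
  by move: i1 i2 i3 i4; rewrite /Ke /k3; clear; lra.
have g4 : (8 * k2 * b + 8 * k3 * (1 + b) - Ke * (1 - t) / 2) * l ^+ 2 <=
    (8 * k2 * b + 8 * k3 * (1 + b) - Ke * (1 - t) / 2) * SI.
  by apply: ler_wpM2l SI_ge; rewrite subr_ge0.
have g5 : (8 * k2 * a + 16 * k3 * a) * (t * l ^+ 2) <=
    (8 * k2 * a + 16 * k3 * a) * SJ.
  by apply: ler_wpM2l SJ_ge; apply: addr_ge0; rewrite mulr_ge0 // mulr_ge0.
have ll : l ^+ 2 = l * c * t by rewrite expr2 {2}lE mulrA.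
suff : 0 < 0 :> R by rewrite ltxx.
move: pC g1 g2 g3 g4 g5.
rewrite /polyC -hs ll /Ke /k3 -/k2 /Phi -/Y; clear; move: k2 Y => k y; lra.
Qed.

(** The weights [2 s - 1] and [X1] cancel [rho]. Since [(2 s - 1) (1 + s) + X1 = Y], the combination
    has the positive common factor [Y]. As before, [KS] keeps the sign of the coefficient of
    [SI]. *)
Lemma region_balanced (R : realFieldType) (a b c s l t e SI SJ rho : R)
    (hc : c = 1 - a) (hs : s = a + b) (a_ge0 : 0 <= a) (b_ge0 : 0 <= b)
    (lE : l = c * t)
    (SI_ge : l ^+ 2 <= SI) (SJ_ge : t * l ^+ 2 <= SJ)
    (Phi := s * e - b * SI - a * SJ) (X1 := 1 - s - 2 * a * b)
    (Y := a ^+ 2 + b ^+ 2 + s ^+ 2) :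
    1 / 2 < s -> 0 <= X1 -> (1 - t) * c <= 1 / 2 - a -> 1 / 2 <= c ->
    1 / 2 <= l -> b <= 1 - l * t -> 0 < polyA a b l c t ->
    4 * e <= 6 * l - l * c + l * t ^+ 2 * c + 2 * (1 - t) * SI ->
    (1 + s) ^+ 2 / 4 <= (1 + s) * Phi + X1 * rho ->
    (1 + s) * (2 - Y) / 8 <= Phi + (1 - 2 * s) * rho ->
  False.
Proof.
move=> s_gt X1_ge0 dc c_ge l_ge b_le pA e_le' cost1 cost2.
have c_gt0 : 0 < c by clear -c_ge; lra.
have s_gt0 : 0 < s by clear -s_gt; lra.
have Y_gt0 : 0 < Y by rewrite ltr_wpDl ?addr_ge0 ?sqr_ge0 ?exprn_gt0.
have PhiY : Y * ((1 + s) * (1 + s + 2 * a * b)) <= Y * (8 * Phi).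
  have s1 : 0 <= 2 * s - 1 by clear -s_gt; lra.
  have := lerD (ler_wpM2l s1 cost1) (ler_wpM2l X1_ge0 cost2).
  rewrite /Y /X1 hs; clear; move: Phi => P; clear; lra.
rewrite ler_pM2l // in PhiY.
have ll4 : 1 / 4 <= l * l.
  by have := ler_pM _ _ l_ge l_ge; rewrite (_ : 1 / 2 * (1 / 2) = 1 / 4);
    [apply; clear; lra | field].
have bc : b * c <= c - 1 / 4.
  have := ler_wpM2r (ltW c_gt0) b_le; rewrite mulrBl mul1r.
  have -> : l * t * c = l * l by rewrite {3}lE; ring.
  by clear -ll4; lra.
have sc : s <= 2 * c.
  rewrite -(ler_pM2r c_gt0) hs mulrDl; apply: le_trans (lerD (lexx _) bc) _.
  have : 0 <= (3 * c - 1 / 2) * (c - 1 / 2).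
    by rewrite mulr_ge0 //; clear -c_ge; lra.
  have -> : a = 1 - c by rewrite hc; ring.
  by clear; lra.
have KS : s * (1 - t) <= 2 * b.
  rewrite -(ler_pM2r c_gt0) -mulrA.
  apply: le_trans (_ : s * b <= _).
    by apply: ler_wpM2l; [exact: ltW | clear -dc s_gt hs; lra].
  by rewrite mulrAC; apply: ler_wpM2r.
have h3 := ler_wpM2l (ltW s_gt0) e_le'.
have k0 : 0 <= 8 * b - 4 * s * (1 - t) by clear -KS; lra.
have h4 := ler_wpM2l k0 SI_ge.
have h5 := ler_wpM2l a_ge0 SJ_ge.
have ll : l ^+ 2 = l * c * t by rewrite expr2 {2}lE mulrA.
suff : 0 < 0 :> R by rewrite ltxx.
move: PhiY h3 h4 h5 pA; rewrite /Phi /polyA -hs ll; clear; lra.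
Qed.

(* In units of m = n/3, counting edges in units of m^2: N(u) and N(v) have sizes
   1 - a and 1 - b, l is the spectral radius, e the number of edges, SI and SJ
   the degree sums over N(u) and N(v), and rho the number of edges avoiding
   both. The last three hypotheses are the inequalities [strategy_uniform],
   [strategy_skew] and [strategy_split]. *)
Lemma scalar_contradiction (R : realFieldType) (a b c s l t e SI SJ rho : R) :
    c = 1 - a -> s = a + b -> 0 <= a -> 0 <= b -> 0 < t -> t <= 1 ->
    l = c * t -> 1 / 2 <= l -> b <= 1 - l * t ->
    l ^+ 2 <= SI -> t * l ^+ 2 <= SJ -> e - SI - SJ <= rho ->
    e <= 3 / 2 * l ->
    4 * e <= 6 * l - l * c + l * t ^+ 2 * c + 2 * (1 - t) * SI ->
    let Phi := s * e - b * SI - a * SJ in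
    (1 + s) ^+ 2 / 4 <= (1 + s) * Phi + (1 - s - 2 * a * b) * rho ->
    (1 + s) * (2 - (a ^+ 2 + b ^+ 2 + s ^+ 2)) / 8 <=
      Phi + (1 - 2 * s) * rho ->
    (1 + s) ^+ 2 * (4 - (1 + b) ^+ 2) / 16 <=
      (1 + s) * (a * (e - SJ) + (1 + b) / 2 * (e - SI))
      - (1 + b) * (1 + b + 3 * a) / 2 * rho ->
  False.
Proof.
move=> hc hs a_ge0 b_ge0 t_gt0 t_le1 lE l_ge b_le SI_ge SJ_ge rho_ge.
move=> e_le e_le' Phi cost1 cost2 cost3.
have ct_ge : 1 / 2 <= c * t by rewrite -lE.
have half_gt0 : 0 < 1 / 2 :> R by clear; lra.
have c_gt0 : 0 < c by rewrite -(pmulr_lgt0 _ t_gt0) (lt_le_trans _ ct_ge).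
have c_ge : 1 / 2 <= c.
  by apply: le_trans ct_ge _; rewrite -[leRHS]mulr1 ler_pM2l.
have a_le : a <= 1 / 2 by clear -hc c_ge; lra.
have c_le1 : c <= 1 by clear -hc a_ge0; lra.
have t_ge : 1 / 2 <= t.
  by apply: le_trans ct_ge _; rewrite -[leRHS]mul1r ler_pM2r.
have lt : l * t = c * t ^+ 2 by rewrite lE expr2 mulrA.
have lt_ge : 1 / 4 <= l * t.
  have := ler_pM (ltW half_gt0) (ltW half_gt0) l_ge t_ge.
  by apply: le_trans; clear; lra.
have arange : 0 <= a <= 1 / 2 by rewrite a_ge0.
have trange : 1 / 2 <= t <= 1 by rewrite t_ge.
have urange : 0 <= 1 - c * t ^+ 2 - b <= 3 / 4.
  by rewrite -lt; apply/andP; split; clear -b_le b_ge0 lt_ge; lra.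
have bE : 1 - (1 - a) * t ^+ 2 - (1 - c * t ^+ 2 - b) = b by rewrite hc; ring.
have dc : (1 - t) * c <= 1 / 2 - a.
  by rewrite mulrBl mul1r (mulrC t) -lE; clear -hc l_ge; lra.
have [X1_le0|X1_gt0] := leP (1 - s - 2 * a * b) 0.
  have pB := polyB_gt0 arange trange urange.
  rewrite /= bE -hc -lE in pB.
  have b34 : b <= 3 / 4 by clear -b_le lt_ge; lra.
  have X1c : c - b - 2 * a * b <= 0.
    by move: X1_le0; rewrite hc hs; clear; lra.
  exact: (region_many_missing hs) (pB l_ge X1c) X1_le0 rho_ge e_le cost1.
have [s_le|s_gt] := leP s (1 / 2).
  have s_le' : a + b <= 1 / 2 by rewrite -hs.
  have := polyC_gt0 a_ge0 b_ge0 s_le' trange; rewrite -hc -lE => pC.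
  exact: (region_few_missing hs) pC e_le' cost2 cost3.
have := polyA_gt0 arange trange urange; rewrite bE -hc -lE => pA.
exact: (region_balanced hc hs) s_gt (ltW X1_gt0) _ _ _ _ pA e_le' cost1 cost2.
Qed.

(** * Colourings built from the neighbourhoods of an edge *)

Section Strategies.
Variables (G : sgraph) (R : realFieldType) (m B : R).
Hypothesis tfG : triangle_free G.
Hypothesis cost_ge : forall x : G -> 'I_3 -> R, feasible m x -> B <= fcost x.
Variables fI fJ fR : G -> R.
Hypotheses (fI0 : forall z, 0 <= fI z) (fJ0 : forall z, 0 <= fJ z).
Hypotheses (fR0 : forall z, 0 <= fR z).
Hypothesis f1 : forall z, fI z + fJ z + fR z = 1.
Hypotheses (indI : qform fI fI = 0) (indJ : qform fJ fJ = 0).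

Let i := mass fI.
Let j := mass fJ.
Let r := mass fR.
Let p1 := (m - i) / r.
Let p2 := (m - j) / r.
Let p3 := m / r.
Let x := qform fI fJ.
Let cI := qform fI fR.
Let cJ := qform fJ fR.
Let rho := qform fR fR / 2.

Hypotheses (i_le : i <= m) (j_le : j <= m) (m_ge0 : 0 <= m).
Hypotheses (r_gt0 : 0 < r) (total : i + j + r = 3 * m).

Definition tricolour (f g h : G -> R) z (k : 'I_3) : R :=
  match (k : nat) with 0 => f z | 1 => g z | _ => h z end.

Lemma sum_ord3 (F : 'I_3 -> R) :
  \sum_k F k = F (inord 0) + F (inord 1) + F (inord 2).
Proof.
rewrite 3!big_ord_recl big_ord0 addr0 addrA; congr (F _ + F _ + F _);
  by apply: val_inj; rewrite /= inordK.
Qed.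

Lemma feasible_tricolour (f g h : G -> R) :
    (forall z, 0 <= f z) -> (forall z, 0 <= g z) -> (forall z, 0 <= h z) ->
    (forall z, f z + g z + h z = 1) ->
    mass f = m -> mass g = m -> mass h = m ->
  feasible m (tricolour f g h).
Proof.
move=> f0 g0 h0 fgh mf mg mh; split=> [z k|z|k].
- by rewrite /tricolour; case: (nat_of_ord k) => [|[|]].
- by rewrite sum_ord3 /tricolour !inordK.
- by rewrite /mass /tricolour; case: (nat_of_ord k) => [|[|]].
Qed.

Lemma fcost_tricolour (f g h : G -> R) :
  fcost (tricolour f g h) = (qform f f + qform g g + qform h h) / 2.
Proof. by rewrite /fcost sum_ord3 /tricolour !inordK. Qed.

Lemma p1_ge0 : 0 <= p1. Proof. by rewrite divr_ge0 ?subr_ge0 // ltW. Qed.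
Lemma p2_ge0 : 0 <= p2. Proof. by rewrite divr_ge0 ?subr_ge0 // ltW. Qed.
Lemma p3_ge0 : 0 <= p3. Proof. by rewrite divr_ge0 // ltW. Qed.

Lemma p_sum : p1 + p2 + p3 = 1.
Proof.
rewrite /p1 /p2 /p3 -!mulrDl (_ : _ + m = r) ?mulfV ?gt_eqF //.
by have := total; lra.
Qed.

Lemma p1E : i + p1 * r = m. Proof. by rewrite /p1; field; rewrite gt_eqF. Qed.
Lemma p2E : j + p2 * r = m. Proof. by rewrite /p2; field; rewrite gt_eqF. Qed.
Lemma p3E : p3 * r = m. Proof. by rewrite /p3; field; rewrite gt_eqF. Qed.

Let base := tricolour (fun z => fI z + p1 * fR z) (fun z => fJ z + p2 * fR z)
                      (fun z => p3 * fR z).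

Lemma feasible_base : feasible m base.
Proof.
apply: feasible_tricolour => [z|z|z|z|||].
- by rewrite addr_ge0 // mulr_ge0 // p1_ge0.
- by rewrite addr_ge0 // mulr_ge0 // p2_ge0.
- by rewrite mulr_ge0 // p3_ge0.
- rewrite -(f1 z) -[X in _ = _ + X]mul1r -p_sum; ring.
- by rewrite massD massZ p1E.
- by rewrite massD massZ p2E.
- by rewrite massZ p3E.
Qed.

Lemma fcost_base :
  fcost base = p1 * cI + p2 * cJ + (p1 ^+ 2 + p2 ^+ 2 + p3 ^+ 2) * rho.
Proof.
rewrite fcost_tricolour !qformE indI indJ (qformC fR fI) (qformC fR fJ).
by rewrite /cI /cJ /rho; field.
Qed.

(** [fR] is spread in the constant proportions that complete [fI], [fJ] and an empty class to mass
    [m]. *)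
Lemma strategy_uniform :
  B <= p1 * cI + p2 * cJ + (p1 ^+ 2 + p2 ^+ 2 + p3 ^+ 2) * rho.
Proof. by rewrite -fcost_base; apply: cost_ge; apply: feasible_base. Qed.

(* [fR] is split evenly into [f + g] by a cheap bisection and the base colouring
   is perturbed by multiples of [f - g]; averaging over the two signs removes the
   linear term. *)
Lemma strategy_skew : p1 + p2 <= p3 ->
  B <= p1 * cI + p2 * cJ + (p3 - p1 - p2) * rho
       + (p1 ^+ 2 + p2 ^+ 2 + (p1 + p2) ^+ 2) * r ^+ 2 / 8.
Proof.
move=> p123; have [f [g [[f0 g0 fg mf mg] cost]]] := bisection fR0 tfG.
rewrite -/r in mf mg cost; pose d z := f z + -1 * g z.
have md : mass d = 0 by rewrite massD massZ mf mg; ring.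
pose h := tricolour (fun z => p1 * d z) (fun z => p2 * d z)
                    (fun z => - (p1 + p2) * d z).
have p10 := p1_ge0; have p20 := p2_ge0.
have aux p v z : `|v| <= p -> 0 <= p * fR z + v * d z.
  rewrite ler_norml => /andP[v1 v2]; rewrite -fg /d.
  have -> : p * (f z + g z) + v * (f z + -1 * g z) =
    (p + v) * f z + (p - v) * g z by ring.
  by rewrite addr_ge0 // mulr_ge0 //; lra.
(* The third colour changes by [p1 + p2] times [d], so [p1 + p2 <= p3] is what keeps it
   nonnegative. *)
have feas (u : R) : `|u| = 1 -> feasible m (fun z k => base z k + u * h z k).
  move=> u1; split=> [z k|z|k].
  - have u12 (p q : R) : 0 <= p -> p <= q -> `|u * p| <= q.
      by move=> p0 pq; rewrite normrM u1 mul1r ger0_norm.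
    rewrite /base /h /tricolour; case: (nat_of_ord k) => [|[|_]].
    + rewrite -addrA addr_ge0 // mulrA; exact/aux/u12.
    + rewrite -addrA addr_ge0 // mulrA; exact/aux/u12.
    + by rewrite mulrA mulrN -mulNr; apply/aux; rewrite mulNr normrN u12 // addr_ge0.
  - have [_ b1 _] := feasible_base; rewrite big_split /= b1 -mulr_sumr.
    by rewrite sum_ord3 /h /tricolour !inordK //; ring.
  - have [_ _ bm] := feasible_base; rewrite massD massZ bm.
    rewrite (_ : mass _ = 0); first by ring.
    by rewrite /h /tricolour; case: (nat_of_ord k) => [|[|_]]; rewrite massZ md mulr0.
have := lerD (cost_ge (feas 1 (normr1 _))) (cost_ge (feas (-1) (normrN1 _))).
rewrite !fcost_line fcost_base.
have -> : fcost h = (p1 ^+ 2 + p2 ^+ 2 + (p1 + p2) ^+ 2) * qform d d / 2.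
  by rewrite fcost_tricolour !qformE; field.
(* Parallelogram law for [d = f - g] and [fR = f + g]. *)
have -> : qform d d = 2 * (qform f f + qform g g) - 2 * rho.
  have -> : rho = (qform f f + 2 * qform f g + qform g g) / 2.
    by rewrite /rho -(eq_qform fg fg) !qformE (qformC g f); field.
  by rewrite /d !qformE (qformC g f); field.
have V0 : 0 <= p1 ^+ 2 + p2 ^+ 2 + (p1 + p2) ^+ 2 by rewrite !addr_ge0 ?sqr_ge0.
have := ler_wpM2l V0 cost.
have -> : p3 - p1 - p2 = p1 ^+ 2 + p2 ^+ 2 + p3 ^+ 2
    - (p1 ^+ 2 + p2 ^+ 2 + (p1 + p2) ^+ 2).
  have -> : p3 = 1 - p1 - p2 by have := p_sum; lra.
  by ring.
lra.
Qed.

(** Only [fI] stays whole, completed by a share of [fR]. The other two colours each receive half of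
    [fJ] and one part of a cheap bisection of the rest of [fR]. *)
Lemma strategy_split :
  B <= p1 * cI + (1 - p1) / 2 * cJ + p1 ^+ 2 * rho + (1 - p1) ^+ 2 * r ^+ 2 / 16.
Proof.
have [f [g [[f0 g0 fg mf mg] cost]]] := bisection fR0 tfG.
rewrite -/r in mf mg cost; have p10 := p1_ge0; have p20 := p2_ge0.
have p30 := p3_ge0; have p11 : 0 <= 1 - p1 by have := p_sum; lra.
have fR_p z : fR z = f z + g z by rewrite fg.
have half0 : 0 <= 1 / 2 :> R by lra.
have mR : i + p1 * r = m by exact: p1E.
have := total => tot.
have mhalf : 1 / 2 * j + (1 - p1) * (r / 2) = m by lra.
have feas : feasible m (tricolour (fun z => fI z + p1 * fR z)
    (fun z => 1 / 2 * fJ z + (1 - p1) * f z)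
    (fun z => 1 / 2 * fJ z + (1 - p1) * g z)).
  apply: feasible_tricolour => [z|z|z|z|||].
  - by rewrite addr_ge0 // mulr_ge0.
  - by rewrite addr_ge0 // mulr_ge0.
  - by rewrite addr_ge0 // mulr_ge0.
  - by have := f1 z; rewrite fR_p; lra.
  - by rewrite massD massZ p1E.
  - by rewrite massD !massZ mf.
  - by rewrite massD !massZ mg.
have := cost_ge feas; rewrite fcost_tricolour !qformE indI indJ.
rewrite (qformC fR fI) (qformC f fJ) (qformC g fJ).
have cJE : cJ = qform fJ f + qform fJ g.
  by rewrite /cJ -qformDr; apply: eq_qform.
have := ler_wpM2l (sqr_ge0 (1 - p1)) cost.
rewrite -/cI (_ : qform fR fR = 2 * rho); last by rewrite /rho; field.
rewrite cJE; lra.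
Qed.

End Strategies.

(** * An edge selected by a Perron vector *)

Section PerronPair.
Variables (G : sgraph) (R : rcfType).
Local Notation one := (fun _ : G => 1 : R).

Lemma mass_nbr z : mass (ind R (nbr z)) = mdeg one z.
Proof. by rewrite mdeg_nbr; apply: eq_mass => w; rewrite mulr1. Qed.

(* [u] maximises a Perron vector and [v] maximises it over the neighbours of
   [u]; [l] is the spectral radius and [t] is [l / deg u]. *)
Lemma perron_pair : 0 < qform one one ->
  exists (u v : G) (l t : R),
    [/\ adj u v, 0 < l, 0 < t, t <= 1 & mdeg one u * t = l] /\
    [/\ l * t <= mdeg one v, l ^+ 2 <= qform (ind R (nbr u)) one,
        t * l ^+ 2 <= qform (ind R (nbr v)) one &
        \sum_z mdeg one z ^+ 2 <= #|G|%:R * l ^+ 2].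
Proof.
move=> Q_gt0.
have G_gt0 : (0 < #|G|)%N.
  rewrite lt0n; apply/eqP => G0; move: Q_gt0; rewrite /qform big1 ?ltxx // => z.
  by have := card0_eq G0 z; rewrite !inE.
have [xi [u [l [xi01 xiu l0 lxi lsum]]]] := perron_vector R G_gt0.
have xi0 z : 0 <= xi z by case/andP: (xi01 z).
have xi1 z : xi z <= 1 by case/andP: (xi01 z).
have deg_xi z : mdeg xi z <= mdeg one z.
  by apply: ler_sum => w _; apply: ler_wpM2l; rewrite ?adjr_ge0.
have l_deg z : l * xi z <= mdeg one z := le_trans (lxi z) (deg_xi z).
have l_gt0 : 0 < l.
  rewrite lt0r l0 andbT; apply: contraTneq Q_gt0 => l00.
  have deg0 z : mdeg one z = 0.
    move: lsum; rewrite l00 expr0n mulr0 => le0.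
    have /eqP : \sum_z mdeg one z ^+ 2 == 0.
      by rewrite eq_le le0 sumr_ge0 // => w _; rewrite sqr_ge0.
    move/eqP; rewrite psumr_eq0 => [/allP/(_ z)|w _]; last exact: sqr_ge0.
    by rewrite mem_index_enum => /(_ isT) /=; rewrite sqrf_eq0 => /eqP.
  by rewrite /qform big1 ?ltxx // => z _; rewrite deg0 mulr0.
have l_u : l <= mdeg xi u by have := lxi u; rewrite xiu mulr1.
have [v0 uv0] : exists w, adj u w.
  apply/existsP; apply: contraTT (lt_le_trans l_gt0 l_u).
  rewrite negb_exists => /forallP nadj; rewrite /mdeg big1 ?ltxx // => w _.
  by rewrite /adjr (negPf (nadj w)) mul0r.
case: (@arg_maxP _ _ _ v0 (adj u) xi uv0) => v uv vmax.
(* By the choice of [v], each term of [mdeg xi u] is at most [xi v]; with [l <= mdeg xi u] this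
   gives [t <= xi v]. *)
have uT : mdeg xi u <= mdeg one u * xi v.
  rewrite /mdeg mulr_suml; apply: ler_sum => w _; rewrite mulr1.
  have [uw|nuw] := boolP (adj u w); last by rewrite /adjr (negPf nuw) !mul0r.
  by apply: ler_wpM2l (vmax w uw); apply: adjr_ge0.
have u_gt0 : 0 < mdeg one u.
  by apply: lt_le_trans l_gt0 _; apply: le_trans l_u _; apply: deg_xi.
pose t := l / mdeg one u.
have tT : t <= xi v.
  by rewrite ler_pdivrMr // mulrC; apply: le_trans l_u uT.
have t_gt0 : 0 < t by rewrite divr_gt0.
have Snbr z : l * mdeg xi z <= qform (ind R (nbr z)) one.
  rewrite mdeg_nbr -massZ; apply: ler_sum => w _.
  by rewrite mulrCA; apply: ler_wpM2l (l_deg w); apply: ind_ge0.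
have mv : l * t <= mdeg xi v.
  by apply: le_trans (lxi v); apply: ler_wpM2l.
exists u, v, l, t; split; split=> //.
- exact: le_trans tT (xi1 v).
- by rewrite /t mulrC divfK ?gt_eqF.
- exact: le_trans mv (deg_xi v).
- by apply: le_trans (Snbr u); rewrite expr2; apply: ler_wpM2l.
- by apply: le_trans (Snbr v); rewrite mulrC expr2 -mulrA; apply: ler_wpM2l.
Qed.

End PerronPair.

Lemma ler_scale (R : realFieldType) (k u v u' v' : R) :
  0 < k -> u = u' * k -> v = v' * k -> u <= v -> u' <= v'.
Proof. by move=> k_gt0 -> ->; rewrite ler_pM2r. Qed.

Lemma small_independence_lt (G : sgraph) (R : rcfType) (m : nat) :
    triangle_free G -> #|G| = (3 * m)%N -> (0 < m)%N ->
    (forall A : {set G},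
      (forall z w, z \in A -> w \in A -> ~~ adj z w) -> (#|A| < m)%N) ->
    3 / 2 * m%:R ^+ 2 < qform (fun _ : G => 1 : R) (fun _ => 1) ->
  (Dbal 3 G)%:R < m%:R ^+ 2 / 4 :> R.
Proof.
move=> tfG cardG m_gt0 small; set one := (fun _ => 1) => dense.
rewrite ltNge; apply/negP=> leD; pose M : R := m%:R; rewrite -/M in leD dense.
have cost_ge (x : G -> 'I_3 -> R) : feasible M x -> M ^+ 2 / 4 <= fcost x.
  by move=> fx; apply: le_trans leD _; apply: Dbal_le_fcost fx.
have M_gt0 : 0 < M by rewrite ltr0n.
have Q_gt0 : 0 < qform one one.
  by apply: le_lt_trans dense; rewrite mulr_ge0 ?sqr_ge0 //; clear; lra.
have [u [v [l [t [[uv l_gt0 t_gt0 t_le1 lE] [jv SI_ge SJ_ge lsum]]]]]] :=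
  perron_pair Q_gt0.
rewrite -/one in lE jv SI_ge SJ_ge lsum.
pose fI := ind R (nbr u); pose fJ := ind R (nbr v).
pose fR z := 1 - fI z - fJ z.
rewrite -/fI -/fJ in SI_ge SJ_ge.
have fI0 (z : G) : 0 <= fI z by apply: ind_ge0.
have fJ0 (z : G) : 0 <= fJ z by apply: ind_ge0.
have fR0 (z : G) : 0 <= fR z.
  rewrite /fR /fI /fJ /ind; have := @nbr_disjoint _ tfG u v z uv.
  by case: (z \in nbr u) => [/(_ isT)/negPf ->|_]; [|case: (z \in nbr v)];
     rewrite /=; clear; lra.
have f1 (z : G) : fI z + fJ z + fR z = 1 by rewrite /fR; ring.
clearbody fR.
have indN (w : G) : qform (ind R (nbr w)) (ind R (nbr w)) = 0.
  by apply: (@qform_independent _ _ (nbr w)) => [|z /negPf|z /negPf];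
     [exact: (nbr_independent tfG) | rewrite /ind => -> ..].
have II : qform fI fI = 0 := indN u; have JJ : qform fJ fJ = 0 := indN v.
set i := mdeg one u in lE; set j := mdeg one v in jv.
have mI : mass fI = i by apply: mass_nbr.
have mJ : mass fJ = j by apply: mass_nbr.
have i_lt : i < M.
  by rewrite -mI mass_ind ltr_nat; apply: small; apply: (nbr_independent tfG).
have j_lt : j < M.
  by rewrite -mJ mass_ind ltr_nat; apply: small; apply: (nbr_independent tfG).
have m1 : mass one = 3 * M.
  by rewrite /mass sumr_const cardG /M -natrM.
pose r := mass fR.
have total : i + j + r = 3 * M.
  by rewrite -m1 -mI -mJ -2!massD; apply: eq_mass => z; apply: f1.
have r_gt0 : 0 < r by clear -total i_lt j_lt M_gt0; lra.
set SI := qform fI one in SI_ge; set SJ := qform fJ one in SJ_ge.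
pose Q := qform one one; pose e := Q / 2; pose rho := qform fR fR / 2.
pose x := qform fI fJ; pose cI := qform fI fR; pose cJ := qform fJ fR.
have oneE (z : G) : 1 = fI z + fJ z + fR z by rewrite f1.
have SIE : SI = x + cI.
  by rewrite /SI (eq_qform (fun=> erefl) oneE) !qformE II add0r.
have SJE : SJ = x + cJ.
  by rewrite /SJ (eq_qform (fun=> erefl) oneE) !qformE JJ addr0 (qformC fJ fI).
have eE : e = x + cI + cJ + rho.
  have QE : Q = 2 * x + 2 * cI + 2 * cJ + qform fR fR.
    rewrite /Q (eq_qform oneE oneE) !qformE II JJ (qformC fJ fI) (qformC fR fI).
    by rewrite (qformC fR fJ) /x /cI /cJ; ring.
  by rewrite /e QE /rho; field.
have x0 : 0 <= x by apply: qform_ge0.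
(* Tangent-line bound: each [tau] turns the bound on the squared degrees into a linear inequality in
   the degrees. The constant [tau = l] gives [Q_le]. *)
have sumdeg (tau : G -> R) :
    \sum_z (2 * tau z * mdeg one z - tau z ^+ 2) <= 3 * M * l ^+ 2.
  have <- : (#|G|%:R : R) = 3 * M by rewrite cardG /M natrM.
  apply: le_trans lsum; apply: ler_sum => z _.
  by have := sqr_ge0 (mdeg one z - tau z); rewrite sqrrB; clear; lra.
have Qsum : Q = \sum_z mdeg one z by apply: eq_bigr => z _; rewrite mul1r.
have Q_le : Q <= 3 * M * l.
  have := sumdeg (fun=> l); rewrite /= sumrB -mulr_sumr -Qsum.
  have -> : \sum_(z : G) l ^+ 2 = 3 * M * l ^+ 2.
    rewrite -[in RHS]m1 mulrC -massZ; apply: eq_bigr => z _.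
    by rewrite mulr1.
  by move=> h; rewrite -(ler_pM2l l_gt0); move: h; clear; lra.
(* Sum [(d - tau)^2 >= 0] with [tau = l * t] on [N(u)] and [tau = l] elsewhere. *)
have e_le' : 4 * e <= 6 * M * l - l * i + l * t ^+ 2 * i + 2 * (1 - t) * SI.
  have := sumdeg (fun z => l - l * (1 - t) * fI z).
  have -> : \sum_z (2 * (l - l * (1 - t) * fI z) * mdeg one z -
      (l - l * (1 - t) * fI z) ^+ 2) = 2 * l * Q - 2 * l * (1 - t) * SI
      - l ^+ 2 * (3 * M) + l ^+ 2 * (1 - t ^+ 2) * i.
    rewrite Qsum -m1 -mI /SI /qform /mass !mulr_sumr -!sumrB -big_split /=.
    apply: eq_bigr => z _; rewrite /fI /ind (_ : one z = 1) //.
    by case: (z \in _) => /=; ring.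
  by move=> h; rewrite -(ler_pM2l l_gt0) /e; move: h; clear; lra.
have lM : M / 2 < l.
  have h := lt_le_trans dense Q_le.
  by rewrite -(ltr_pM2l M_gt0); move: h; clear; lra.
(* Arithmetic-geometric mean applied to [i j >= l^2 >= (M / 2)^2]. It yields [s <= 1], the condition
   [p1 + p2 <= p3] of [strategy_skew]. *)
have ij : M <= i + j.
  have lij : l * l <= i * j.
    rewrite -{1}lE -mulrA (mulrC t) ler_pM2l //.
    by rewrite -(pmulr_lgt0 _ t_gt0) lE.
  have ij0 : 0 <= i + j by rewrite addr_ge0 // -?mI -?mJ; apply: mass_ge0.
  rewrite -ler_sqr ?nnegrE ?(ltW M_gt0) //.
  have Ml : M / 2 * (M / 2) <= l * l.
    by apply: ler_pM; rewrite ?divr_ge0 ?ltW.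
  by have := sqr_ge0 (i - j); move: Ml lij; clear; lra.
have i0 : 0 < i by rewrite -(pmulr_lgt0 _ t_gt0) lE.
pose a := 1 - i / M; pose b := 1 - j / M; pose s := a + b.
have iM : i = (1 - a) * M by rewrite /a; field; rewrite gt_eqF.
have jM : j = (1 - b) * M by rewrite /b; field; rewrite gt_eqF.
have rM : r = (1 + s) * M by rewrite /s; lra.
have a0 : 0 <= a by rewrite subr_ge0 ler_pdivrMr // mul1r ltW.
have b0 : 0 <= b by rewrite subr_ge0 ler_pdivrMr // mul1r ltW.
clearbody a b.
have s1_gt0 : 0 < 1 + s by rewrite -(pmulr_lgt0 _ M_gt0) -rM.
have p1E : (M - mass fI) / mass fR = a / (1 + s).
  by rewrite mI -/r iM rM; field; rewrite !gt_eqF.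
have p2E : (M - mass fJ) / mass fR = b / (1 + s).
  by rewrite mJ -/r jM rM; field; rewrite !gt_eqF.
have p3E : M / mass fR = 1 / (1 + s).
  by rewrite -/r rM; field; rewrite !gt_eqF.
have tot : mass fI + mass fJ + mass fR = 3 * M by rewrite mI mJ.
have iM' : mass fI <= M by rewrite mI ltW.
have jM' : mass fJ <= M by rewrite mJ ltW.
have c1 := strategy_uniform cost_ge fI0 fJ0 fR0 f1 (indN u) (indN v) iM' jM'
  (ltW M_gt0) r_gt0 tot.
have s_le1 : s <= 1.
  rewrite -(ler_pM2r M_gt0) mul1r; move: ij; rewrite iM jM /s; clear; lra.
have p_le : a / (1 + s) + b / (1 + s) <= 1 / (1 + s).
  by rewrite -mulrDl ler_pM2r ?invr_gt0.
have c2 := strategy_skew tfG cost_ge fI0 fJ0 fR0 f1 (indN u) (indN v) iM' jM'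
  (ltW M_gt0) r_gt0 tot.
have c3 := strategy_split tfG cost_ge fI0 fJ0 fR0 f1 (indN u) (indN v) iM' jM'
  (ltW M_gt0) r_gt0 tot.
rewrite p1E p2E p3E in c1 c2; rewrite p1E in c3; have {}c2 := c2 p_le.
rewrite -/cI -/cJ -/rho -/r rM in c1 c2 c3.
have cIE : cI = e - SJ - rho by rewrite eE SJE; ring.
have cJE : cJ = e - SI - rho by rewrite eE SIE; ring.
rewrite cIE cJE in c1 c2 c3.
have M2 : 0 < M ^+ 2 by rewrite exprn_gt0.
have Mn0 : M != 0 by rewrite gt_eqF.
have s1n0 : 1 + (a + b) != 0 by rewrite gt_eqF.
have K_gt0 : 0 < M ^+ 2 / (1 + s) ^+ 2 by rewrite divr_gt0 // exprn_gt0.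
have K1_gt0 : 0 < M ^+ 2 / (1 + s) by rewrite divr_gt0.
have h_b : b <= 1 - l / M * t.
  apply: (@ler_scale _ M _ _ _ _ M_gt0 _ _ (_ : M - j <= M - l * t)).
  - by rewrite jM; ring.
  - by field.
  - by rewrite lerD2l lerN2.
have h_SI : (l / M) ^+ 2 <= SI / M ^+ 2.
  by rewrite expr_div_n ler_pM2r ?invr_gt0.
have h_SJ : t * (l / M) ^+ 2 <= SJ / M ^+ 2.
  by rewrite expr_div_n mulrA ler_pM2r ?invr_gt0.
have h_rho : e / M ^+ 2 - SI / M ^+ 2 - SJ / M ^+ 2 <= rho / M ^+ 2.
  rewrite -!mulrBl ler_pM2r ?invr_gt0 // SIE SJE eE.
  by move: x0; clear; lra.
have h_e : e / M ^+ 2 <= 3 / 2 * (l / M).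
  apply: (@ler_scale _ (M ^+ 2) _ _ _ _ M2 _ _ (_ : e <= 3 / 2 * M * l)).
  - by field.
  - by field.
  - by rewrite /e; move: Q_le; clear; lra.
have h_e' : 4 * (e / M ^+ 2) <= 6 * (l / M) - l / M * (1 - a) +
    l / M * t ^+ 2 * (1 - a) + 2 * (1 - t) * (SI / M ^+ 2).
  apply: (ler_scale M2) e_le'; first by field.
  by rewrite iM; field.
have h1 : (1 + s) ^+ 2 / 4 <=
    (1 + s) * (s * (e / M ^+ 2) - b * (SI / M ^+ 2) - a * (SJ / M ^+ 2)) +
    (1 - s - 2 * a * b) * (rho / M ^+ 2).
  apply: (ler_scale K_gt0) c1; rewrite /s; first by field; rewrite ?Mn0 ?s1n0.
  by field; rewrite ?Mn0 ?s1n0.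
have h2 : (1 + s) * (2 - (a ^+ 2 + b ^+ 2 + s ^+ 2)) / 8 <=
    s * (e / M ^+ 2) - b * (SI / M ^+ 2) - a * (SJ / M ^+ 2) +
    (1 - 2 * s) * (rho / M ^+ 2).
  rewrite -lerBlDr in c2.
  apply: (ler_scale K1_gt0) c2; rewrite /s; first by field; rewrite ?Mn0 ?s1n0.
  by field; rewrite ?Mn0 ?s1n0.
have h3 : (1 + s) ^+ 2 * (4 - (1 + b) ^+ 2) / 16 <=
    (1 + s) * (a * (e / M ^+ 2 - SJ / M ^+ 2) +
      (1 + b) / 2 * (e / M ^+ 2 - SI / M ^+ 2)) -
    (1 + b) * (1 + b + 3 * a) / 2 * (rho / M ^+ 2).
  rewrite -lerBlDr in c3.
  apply: (ler_scale K_gt0) c3; rewrite /s; first by field; rewrite ?Mn0 ?s1n0.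
  by field; rewrite ?Mn0 ?s1n0.
have h_l : l / M = (1 - a) * t by rewrite -lE iM; field.
have h_l2 : 1 / 2 <= l / M by rewrite ler_pdivlMr //; move: lM; clear; lra.
exact: (scalar_contradiction erefl erefl a0 b0 t_gt0 t_le1 h_l h_l2 h_b h_SI h_SJ
  h_rho h_e h_e' h1 h2 h3).
Qed.

(** * Large independent sets *)

Definition independent (G : sgraph) (A : {set G}) : Prop :=
  forall z w, z \in A -> w \in A -> ~~ adj z w.

Lemma independentS (G : sgraph) (A B : {set G}) :
  A \subset B -> independent B -> independent A.
Proof. by move=> /subsetP AB iB z w /AB zB /AB; apply: iB. Qed.

Section Cases.
Variables (G : sgraph) (R : realFieldType) (m : nat).
Hypothesis tfG : triangle_free G.
Hypothesis cardG : #|G| = (3 * m)%N.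
Hypothesis m_gt0 : (0 < m)%N.
Local Notation one := (fun _ : G => 1 : R).
Local Notation M := (m%:R : R).
Implicit Types (A B : {set G}).

Lemma qform_ind_independent A : independent A -> qform (ind R A) (ind R A) = 0.
Proof.
by move=> iA; apply: (qform_independent iA) => z /negPf; rewrite /ind => ->.
Qed.

Lemma sparse_lt : qform one one <= 3 / 2 * M ^+ 2 ->
  (Dbal 3 G)%:R < M ^+ 2 / 4.
Proof.
have M_gt0 : 0 < M by rewrite ltr0n.
have M2 : 0 < M ^+ 2 by rewrite exprn_gt0.
move=> leQ; pose x (z : G) (k : 'I_3) : R := 1 / 3.
have fx : feasible M x.
  split=> [z k|z|k]; first by rewrite /x; lra.
    by rewrite sum_ord3 /x; field.
  by rewrite /mass /x sumr_const cardG mulrnA -[1 / 3 *+ 3]mulr_natr mul1r mulVf ?pnatr_eq0.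
have cx : fcost x = qform one one / 6.
  rewrite /fcost sum_ord3 /x.
  have xE (z : G) : 1 / 3 = 1 / 3 * one z by rewrite mulr1.
  by rewrite (eq_qform xE xE) !qformE; field.
(* The strict gain needs an edge; without edges the cost is 0. *)
have [/existsP[v /existsP[w vw]]|] := boolP [exists v : G, exists w, adj v w].
  apply: lt_le_trans (_ : fcost x <= _); last by rewrite cx; lra.
  apply: (@Dbal_lt_fcost G R m x v w ord0 (lift ord0 ord0) fx vw) => //;
    rewrite /x; lra.
rewrite negb_exists => /forallP nadj.
apply: le_lt_trans (Dbal_le_fcost fx) _; rewrite cx (_ : qform _ _ = 0).
  by lra.
apply: big1 => z _; rewrite mul1r /mdeg big1 // => w _.
have := nadj z; rewrite negb_exists => /forallP/(_ w)/negPf.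
by rewrite /adjr => ->; rewrite mul0r.
Qed.

Lemma one_independent_lt A : independent A -> #|A| = m ->
    (forall B, B \subset ~: A -> independent B -> (#|B| < m)%N) ->
  (Dbal 3 G)%:R < M ^+ 2 / 4.
Proof.
move=> iA cA small; pose mu := ind R (~: A).
have mu0 z : 0 <= mu z by apply: ind_ge0.
have M_gt0 : 0 < M by rewrite ltr0n.
have cAC : #|~: A| = (2 * m)%N by have := cardsC A; rewrite cA cardG; lia.
have mr : mass mu = 2 * M by rewrite mass_ind cAC natrM.
have r_gt0 : 0 < mass mu by rewrite mr mulr_gt0.
have degE v : mdeg mu v = #|nbr v :&: ~: A|%:R.
  rewrite mdeg_nbr -mass_ind; apply: eq_mass => z.
  by rewrite /mu /ind in_setI; do 2!case: (z \in _); rewrite ?(mul0r, mulr0, mulr1).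
have degM v : mdeg mu v < M.
  rewrite degE ltr_nat; apply: small; first exact: subsetIr.
  by apply: independentS (subsetIl _ _) _ => z w; apply: nbr_independent.
have degr v : mdeg mu v <= mass mu / 2.
  by have := degM v; rewrite mr; lra.
have [v] := nbr_bisection mu0 tfG r_gt0 degr; rewrite /=.
set p := (_ / _) => cost.
have rd : 0 < mass mu - mdeg mu v by have := degM v; rewrite mr; lra.
have p0 : 0 < p by rewrite divr_gt0 //; have := degM v; rewrite mr; lra.
have p1 : 0 < 1 - p.
  by rewrite subr_gt0 ltr_pdivrMr //; have := degM v; rewrite mr; lra.
set f := (fun z => _ + _) in cost; set g := (fun z => (1 - p) * _) in cost.
have far0 := far_part_ge0 mu0; have nbr0 := nbr_part_ge0 mu0.
have feas : feasible M (tricolour (ind R A) f g).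
  apply: feasible_tricolour => [z|z|z|z|||].
  - exact: ind_ge0.
  - by rewrite addr_ge0 // mulr_ge0 // ltW.
  - by rewrite mulr_ge0 // ltW.
  - have := nbr_partE mu v z; rewrite /f /g /mu /ind inE.
    by case: (z \in A) => /=; lra.
  - by rewrite mass_ind cA.
  - rewrite massD massZ mass_nbr_part mass_far_part /p mr; field.
    by rewrite -mr gt_eqF.
  - rewrite massZ mass_far_part /p mr; field.
    by rewrite -mr gt_eqF.
have costE : fcost (tricolour (ind R A) f g) <= M ^+ 2 / 4.
  rewrite fcost_tricolour qform_ind_independent // add0r.
  by move: cost; rewrite mr; lra.
(* The ends of an edge outside [A] and N(v) both carry the weights [p] and [1 - p], so rounding
   gains. Without such an edge that set is independent, yet N(v) takes fewer than [m] of the [2 m]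
   vertices outside [A], so it has more than [m]. *)
have [/existsP[z /existsP[w /and3P[zF wF zw]]]|] :=
    boolP [exists z, exists w, [&& z \in ~: A :\: nbr v, w \in ~: A :\: nbr v
                              & adj z w]].
  have farE y : y \in ~: A :\: nbr v -> f y = p /\ g y = 1 - p.
    rewrite !inE /f /g /nbr_part /far_part /mu /ind => /andP[/negPf -> yA].
    by rewrite !inE yA mulr1 mulr1 add0r.
  have [fz gz] := farE z zF; have [fw gw] := farE w wF.
  apply: lt_le_trans costE.
  apply: (@Dbal_lt_fcost G R m _ z w (inord 1) (inord 2) feas zw);
    rewrite /tricolour -?val_eqE /= ?inordK // ?fz ?gz ?fw ?gw //.
rewrite negb_exists => /forallP nadj.
have indF : independent (~: A :\: nbr v).
  move=> z w zF wF; have := nadj z; rewrite negb_exists => /forallP/(_ w).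
  by rewrite zF wF.
have := small _ (subsetDl _ _) indF.
have := degM v; rewrite degE ltr_nat setIC.
by have := cardsID (nbr v) (~: A); rewrite cAC; lia.
Qed.

End Cases.

(** * The extremal graphs *)

Lemma complete_bipartite_iso (G : sgraph) (S : {set G}) :
    independent S -> independent (~: S) ->
    (forall z w, z \in S -> w \notin S -> adj z w) ->
  isomorphic G (Kbip #|S| #|~: S|).
Proof.
move=> iS iC cS.
pose g (x : Kbip #|S| #|~: S|) : G :=
  match x with inl i => enum_val i | inr j => enum_val j end.
have gS i : g (inl i) \in S by apply: enum_valP.
have gC j : g (inr j) \notin S by have := enum_valP j; rewrite inE.
have g_inj : injective g.
  move=> [i|i] [j|j] eg.
  - by rewrite (enum_val_inj eg).
  - by have := gC j; rewrite -eg gS.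
  - by have := gC i; rewrite eg gS.
  - by rewrite (enum_val_inj eg).
have [f gK fK] : bijective g.
  by apply: inj_card_bij g_inj _; rewrite card_sum !card_ord cardsC.
exists f; first by exists g.
suff adjg x y : adj (g x) (g y) = Kbip_adj x y 
  by move=> z w; rewrite -{2}[z]fK -{2}[w]fK adjg.
case: x y => [i|i] [j|j] /=.
- by rewrite (negPf (iS _ _ (gS i) (gS j))).
- exact: cS (gS i) (gC j).
- by rewrite adj_sym; apply: cS (gS j) (gC i).
- by rewrite (negPf (iC _ _ _ _)) // inE gC.
Qed.

Section Structure.
Variables (G : sgraph) (R : realFieldType) (h : nat).
Hypothesis tfG : triangle_free G.
Hypothesis h_gt0 : (0 < h)%N.
Local Notation H := (h%:R : R).
Local Notation I := (ind R).
Hypothesis cost_ge : forall x : G -> 'I_3 -> R,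
  feasible (2 * H) x -> H ^+ 2 <= fcost x.
Implicit Types (A X Y : {set G}).

(* [A1], [A2] and [X :|: Y] are the classes of a balanced partition of minimum
   cost. *)
Definition blocks A1 A2 X Y : Prop :=
  [/\ forall z, I A1 z + I A2 z + I X z + I Y z = 1,
      [/\ independent A1, independent A2, independent X & independent Y],
      [/\ mass (I A1) = 2 * H, mass (I A2) = 2 * H, mass (I X) = H
        & mass (I Y) = H] &
      forall x y, x \in X -> y \in Y -> adj x y].

Lemma blocksC A1 A2 X Y : blocks A1 A2 X Y -> blocks A2 A1 X Y.
Proof.
case=> part [i1 i2 iX iY] [m1 m2 mX mY] cXY; split=> // z.
by rewrite -(part z); ring.
Qed.

Lemma blocksX A1 A2 X Y : blocks A1 A2 X Y -> blocks A1 A2 Y X.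
Proof.
case=> part [i1 i2 iX iY] [m1 m2 mX mY] cXY; split=> // [z|x y xX yY].
  by rewrite -(part z); ring.
by rewrite adj_sym cXY.
Qed.

Lemma H_gt0 : 0 < H. Proof. by rewrite ltr0n. Qed.

(** Equality case of [mdeg_le_mass]. *)
Lemma mdeg_full (f : G -> R) z : (forall w, 0 <= f w) -> mass f <= mdeg f z ->
  forall w, 0 < f w -> adj z w.
Proof.
move=> f0 le w fw; apply: contraTT le => nzw; rewrite -ltNge.
rewrite /mdeg /mass (bigD1 w) //= [ltRHS](bigD1 w) //=.
rewrite /adjr (negPf nzw) mul0r ltr_leD //; apply: ler_sum => v _.
by rewrite -[leRHS]mul1r ler_wpM2r // adjr_le1.
Qed.

Lemma mdeg_eq0 (A : {set G}) z : (forall w, w \in A -> ~~ adj z w) ->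
  mdeg (I A) z = 0.
Proof.
move=> nA; rewrite /mdeg big1 // => w _; rewrite /ind.
case: (boolP (w \in A)) => [/nA/negPf|_]; last by rewrite mulr0.
by rewrite /adjr => ->; rewrite mul0r.
Qed.

Lemma mdeg_complete (A : {set G}) z : (forall w, w \in A -> adj z w) ->
  mdeg (I A) z = mass (I A).
Proof.
move=> cA; apply: eq_bigr => w _; rewrite /ind.
case: (boolP (w \in A)) => [/cA zw|_]; last by rewrite mulr0.
by rewrite /adjr zw mulr1.
Qed.

Lemma qform_diracr (f : G -> R) z : qform f (dirac R z) = mdeg f z.
Proof.
rewrite qformC /qform (bigD1 z) //= {1}/dirac eqxx mul1r big1 ?addr0 // => w.
by move/negPf => wz; rewrite /dirac wz mul0r.
Qed.

Lemma blocks_in A1 A2 X Y z : blocks A1 A2 X Y -> z \in A1 ->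
  [/\ I A1 z = 1, I A2 z = 0, I X z = 0 & I Y z = 0].
Proof.
case=> part _ _ _ z1; have := part z; rewrite {1 5}/ind z1 /=.
have := ind_ge0 R A2 z; have := ind_ge0 R X z; have := ind_ge0 R Y z.
by move=> *; split; lra.
Qed.

(** Let [z] and [y] swap classes. An edge between them is counted in both degree terms on the right
    but still joins different classes, hence the correction by 2. *)
Lemma exchange A1 A2 X Y z y : blocks A1 A2 X Y -> z \in A1 -> y \in Y ->
  H + 2 * adjr R z y <= mdeg (I A1) y + (mdeg (I X) z + mdeg (I Y) z).
Proof.
move=> bl z1 yY; have [part [i1 i2 iX iY] [m1 m2 mX mY] cXY] := bl.
have [z11 z12 z1X z1Y] := blocks_in bl z1.
have yY1 : I Y y = 1 by rewrite /ind yY.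
have := ind_ge0 R A1 y; have := ind_ge0 R A2 y; have := ind_ge0 R X y.
have := part y => p y_X y_2 y_1.
have y10 : I A1 y = 0 by lra.
pose f1 w := I A1 w + (dirac R y w + -1 * dirac R z w).
pose f3 w := I X w + I Y w + (dirac R z w + -1 * dirac R y w).
have zy : (z == y) = false.
  by apply/eqP=> ezy; move: z1Y; rewrite ezy yY1 => /eqP; rewrite oner_eq0.
have feas : feasible (2 * H) (tricolour f1 (I A2) f3).
  apply: feasible_tricolour => [w|w|w|w|||].
  - rewrite /f1 /dirac; have := ind_ge0 R A1 w.
    case: (eqVneq w z) => [->|_]; first by rewrite zy z11 /=; lra.
    by case: (w == y) => /=; lra.
  - exact: ind_ge0.
  - rewrite /f3 /dirac; have := ind_ge0 R X w; have := ind_ge0 R Y w.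
    case: (eqVneq w y) => [->|_]; first by rewrite eq_sym zy yY1 /=; lra.
    by case: (w == z) => /=; lra.
  - by rewrite -(part w) /f1 /f3; ring.
  - by rewrite massD massD massZ !mass_dirac m1; ring.
  - exact: m2.
  - by rewrite massD !massD massZ !mass_dirac mX mY; ring.
have := cost_ge feas; rewrite fcost_tricolour /f1 /f3.
have c1 : mdeg (I A1) z = 0 by apply: mdeg_eq0 => w; apply: i1.
have cXy : mdeg (I X) y = H.
  by rewrite mdeg_complete // => w wX; rewrite adj_sym cXY.
have cYy : mdeg (I Y) y = 0 by apply: mdeg_eq0 => w; apply: iY.
have qXY : qform (I X) (I Y) = H ^+ 2.
  rewrite /qform (eq_bigr (fun w => H * I X w)) => [|w _].
    by rewrite -mulr_sumr -/(mass (I X)) mX.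
  rewrite {1 3}/ind; case: (boolP (w \in X)) => wX; last by rewrite mul0r mulr0.
  by rewrite mdeg_complete ?mY ?mul1r ?mulr1 // => v; apply: cXY.
rewrite !qformE !qform_dirac !(qformC (dirac R _) (I _)) !qform_diracr.
rewrite !adjr_irrefl (qform_ind_independent R i1) (qform_ind_independent R i2).
rewrite (qform_ind_independent R iX) (qform_ind_independent R iY).
rewrite (qformC (I Y)) qXY c1 cXy cYy (adjrC R y z); lra.
Qed.

Lemma one_sided A1 A2 X Y z : blocks A1 A2 X Y ->
  mdeg (I X) z = 0 \/ mdeg (I Y) z = 0.
Proof.
case=> part [i1 i2 iX iY] [m1 m2 mX mY] cXY.
have [/existsP[x /andP[xX zx]]|] := boolP [exists x, (x \in X) && adj z x].
  right; apply: mdeg_eq0 => y yY; apply/negP=> zy.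
  by have := tfG z x y; rewrite zx cXY // adj_sym zy.
rewrite negb_exists => /forallP nX; left; apply: mdeg_eq0 => x xX.
by have := nX x; rewrite xX.
Qed.

(** Mass [H] taken uniformly from [a] joins [Y] at no cost. The rest of [A1] joins [X], where only
    edges between [a] and [X] count; their weight is at most [H (al - H)], below [H^2] because [b]
    is nonempty. *)
Lemma mixed_contradiction A1 A2 X Y (a b : {set G}) : blocks A1 A2 X Y ->
    (forall z, I A1 z = I a z + I b z) ->
    (forall z y, z \in a -> y \in Y -> ~~ adj z y) ->
    (forall z x, z \in b -> x \in X -> ~~ adj z x) ->
    H <= mass (I a) -> 0 < mass (I b) ->
  False.
Proof.
move=> [part [i1 i2 iX iY] [m1 m2 mX mY] cXY] ab naY nbX ha hb.
have h0 := H_gt0.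
have mab : mass (I a) + mass (I b) = 2 * H by rewrite -m1 (eq_mass ab) massD.
set al := mass (I a) in ha mab; pose p := H / al.
have al0 : 0 < al by lra.
have p0 : 0 <= p by rewrite divr_ge0 // ltW.
have p1 : p <= 1 by rewrite ler_pdivrMr // mul1r.
have ind0 (A : {set G}) w : 0 <= I A w := ind_ge0 R A w.
pose f w := I Y w + p * I a w.
pose g w := I X w + (I b w + (1 - p) * I a w).
have feas : feasible (2 * H) (tricolour f g (I A2)).
  apply: feasible_tricolour => [w|w|w|w|||].
  - by rewrite addr_ge0 // mulr_ge0.
  - by rewrite !addr_ge0 // mulr_ge0 // subr_ge0.
  - by [].
  - by rewrite -(part w) ab /f /g; ring.
  - by rewrite massD massZ mY -/al /p; field; rewrite gt_eqF.
  - rewrite massD massD massZ mX -/al /p mulrBl divfK ?gt_eqF // mul1r.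
    by rewrite -mab; ring.
  - exact: m2.
have sub z : (z \in a -> z \in A1) /\ (z \in b -> z \in A1).
  have := ab z; rewrite /ind.
  by case: (z \in A1); case: (z \in a); case: (z \in b) => //= e; split=> // _;
    exfalso; lra.
have qaa : qform (I a) (I a) = 0.
  by apply: qform_ind_independent => z w /(sub z).1 + /(sub w).1; apply: i1.
have qbb : qform (I b) (I b) = 0.
  by apply: qform_ind_independent => z w /(sub z).2 + /(sub w).2; apply: i1.
have q0 (A B : {set G}) : (forall z w, z \in A -> w \in B -> ~~ adj z w) ->
    qform (I A) (I B) = 0.
  move=> nAB; apply: big1 => z _; rewrite {1}/ind.
  case: (boolP (z \in A)) => [zA|_]; last by rewrite mul0r.
  by rewrite mdeg_eq0 ?mulr0 // => w; apply: nAB.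
have qab : qform (I a) (I b) = 0.
  by apply: q0 => z w /(sub z).1 + /(sub w).2; apply: i1.
have qaY : qform (I a) (I Y) = 0 by apply: q0.
have qbX : qform (I b) (I X) = 0 by apply: q0.
have qaX : qform (I a) (I X) <= al * H.
  rewrite -mX mulrC /al -massZ; apply: ler_sum => z _; rewrite mulrC.
  by apply: ler_wpM2r; rewrite ?ind_ge0 // mdeg_le_mass // => w; apply: ind_ge0.
have := cost_ge feas; rewrite fcost_tricolour !qformE.
rewrite (qform_ind_independent R iY) (qform_ind_independent R iX).
rewrite (qform_ind_independent R i2) qaa qbb (qformC (I Y)) qaY.
rewrite (qformC (I X) (I b)) qbX (qformC (I b) (I a)) qab (qformC (I X)).
have : (1 - p) * qform (I a) (I X) <= (1 - p) * (al * H).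
  by apply: ler_wpM2l; rewrite ?subr_ge0.
have -> : (1 - p) * (al * H) = H * (al - H) by rewrite /p; field; rewrite gt_eqF.
have : H * (al - H) < H * H by rewrite ltr_pM2l //; lra.
rewrite expr2; lra.
Qed.

(** With no edges between [A1] and [Y], [exchange] leaves [mdeg (I X) z] at least [H], the whole
    mass of [X]. *)
Lemma attached_to A1 A2 X Y : blocks A1 A2 X Y ->
    (forall z, z \in A1 -> mdeg (I Y) z = 0) ->
  forall z x, z \in A1 -> x \in X -> adj z x.
Proof.
move=> bl nY z x z1 xX; have [part [i1 i2 iX iY] [m1 m2 mX mY] cXY] := bl.
have [y yY] : exists y, y \in Y.
  by apply/card_gt0P; rewrite -(ltr_nat R) -mass_ind mY H_gt0.
apply: (@mdeg_full (I X)) => [w||]; first exact: ind_ge0; last first.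
  by rewrite /ind xX.
have nyz w : w \in A1 -> ~~ adj y w.
  move=> w1; apply/negP=> yw; have := nY w w1; apply/eqP; rewrite gt_eqF //.
  rewrite /mdeg (bigD1 y) //= /adjr adj_sym yw /ind yY mulr1 ltr_pwDl //.
  by apply: sumr_ge0 => v _; rewrite mulr_ge0 ?adjr_ge0 ?ler0n.
have := exchange bl z1 yY; rewrite (nY z z1) (mdeg_eq0 nyz) mX.
by have := adjr_ge0 R z y; lra.
Qed.

(** If [A1] had neighbours on both sides, [one_sided] would split it into two nonempty parts, and
    the part with at least half of [A1] would feed [mixed_contradiction]. *)
Lemma attached A1 A2 X Y : blocks A1 A2 X Y ->
  (forall z x, z \in A1 -> x \in X -> adj z x) \/
  (forall z y, z \in A1 -> y \in Y -> adj z y).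
Proof.
move=> bl.
have [/forall_inP nY|] := boolP [forall z in A1, mdeg (I Y) z == 0].
  by left; apply: attached_to bl _ => z /nY/eqP.
rewrite negb_forall_in => /exists_inP[z1 z11 z1Y].
have [/forall_inP nX|] := boolP [forall z in A1, mdeg (I X) z == 0].
  by right; apply: attached_to (blocksX bl) _ => z /nX/eqP.
rewrite negb_forall_in => /exists_inP[z2 z21 z2X]; exfalso.
pose a := [set z in A1 | mdeg (I X) z != 0].
pose b := [set z in A1 | mdeg (I X) z == 0].
have abE z : I A1 z = I a z + I b z.
  by rewrite /ind !inE; case: (z \in A1); case: eqVneq => _ /=; ring.
have pos (A B : {set G}) z w : z \in A -> adj z w -> w \in B ->
    mdeg (I B) z != 0.
  move=> _ zw wB; rewrite gt_eqF // /mdeg (bigD1 w) //= /adjr zw /ind wB mulr1.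
  by rewrite ltr_pwDl // sumr_ge0 // => v _; rewrite mulr_ge0 ?adjr_ge0 ?ler0n.
have naY z y : z \in a -> y \in Y -> ~~ adj z y.
  rewrite inE => /andP[zA /eqP zX] yY; apply/negP=> zy.
  by have [//|/eqP] := one_sided z bl; rewrite (negPf (pos _ _ _ _ zA zy yY)).
have nbX z x : z \in b -> x \in X -> ~~ adj z x.
  rewrite inE => /andP[zA zX] xX; apply/negP=> zx.
  by move: zX; rewrite (negPf (pos _ _ _ _ zA zx xX)).
have [part [i1 i2 iX iY] [m1 m2 mX mY] cXY] := bl.
have mab : mass (I a) + mass (I b) = 2 * H by rewrite -m1 (eq_mass abE) massD.
have a0 : 0 < mass (I a).
  by rewrite mass_ind ltr0n; apply/card_gt0P; exists z2; rewrite inE z21.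
have b0 : 0 < mass (I b).
  rewrite mass_ind ltr0n; apply/card_gt0P; exists z1; rewrite inE z11 /=.
  by have [->//|/eqP] := one_sided z1 bl; rewrite (negPf z1Y).
have [ha|/ltW ha] := leP H (mass (I a)).
  exact: mixed_contradiction bl abE naY nbX ha b0.
apply: (mixed_contradiction (blocksX bl) (a := b) (b := a)) => //.
  by move=> z; rewrite abE addrC.
by lra.
Qed.

End Structure.

Lemma subset_of_card (T : finType) (A : {set T}) m : (m <= #|A|)%N ->
  exists2 B : {set T}, B \subset A & #|B| = m.
Proof.
move=> mA; exists [set x in take m (enum A)].
  by apply/subsetP=> x; rewrite inE => /mem_take; rewrite mem_enum.
rewrite cardsE; have /card_uniqP -> : uniq (take m (enum A)).
  exact: take_uniq (enum_uniq _).
by rewrite size_takel // -cardE.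
Qed.

Lemma independentP (G : sgraph) (A : {set G}) :
  reflect (independent A) [forall z in A, forall w in A, ~~ adj z w].
Proof.
apply: (iffP forall_inP) => [iA z w zA wA|iA z zA].
  by have /forall_inP/(_ w wA) := iA z zA.
by apply/forall_inP=> w; apply: iA.
Qed.

(** * Identification of the two extremal graphs *)

Section Extremal.
Variables (G : sgraph) (R : realFieldType).
Hypothesis tfG : triangle_free G.
Local Notation I := (ind R).
Implicit Types (A X Y : {set G}).

Section TwoIndependent.
Variables (m : nat) (A1 A2 : {set G}).
Hypotheses (i1 : independent A1) (i2 : independent A2).
Hypotheses (c1 : #|A1| = m) (c2 : #|A2| = m) (d12 : [disjoint A1 & A2]).
Hypotheses (cardG : #|G| = (3 * m)%N) (m_gt0 : (0 < m)%N).
Local Notation M := (m%:R : R).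

Let A3 := ~: (A1 :|: A2).
Let base := tricolour (I A1) (I A2) (I A3).

Lemma thirds z : I A1 z + I A2 z + I A3 z = 1.
Proof.
have := disjointFr d12 (x := z); rewrite /ind !inE.
by case: (z \in A1) => [/(_ isT) ->|_]; [|case: (z \in A2)]; rewrite /=; ring.
Qed.

Lemma mass_third : mass (I A3) = M.
Proof.
have : mass (I A1) + mass (I A2) + mass (I A3) = 3 * M.
  rewrite -2!massD (eq_mass thirds) /mass sumr_const cardG.
  by rewrite natrM.
by rewrite !mass_ind c1 c2; lra.
Qed.

Lemma feasible_thirds : feasible M base.
Proof.
apply: feasible_tricolour thirds _ _ _; rewrite ?mass_ind ?c1 ?c2 //;
  first [exact: ind_ge0 | by rewrite -mass_ind mass_third].
Qed.

Lemma fcost_thirds : fcost base = qform (I A3) (I A3) / 2.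
Proof.
rewrite fcost_tricolour (qform_ind_independent R i1) (qform_ind_independent R i2).
by rewrite !add0r.
Qed.

Lemma two_independent_le : (Dbal 3 G)%:R <= M ^+ 2 / 4.
Proof.
apply: le_trans (Dbal_le_fcost feasible_thirds) _.
have := mantel tfG (ind_ge0 R A3); rewrite fcost_thirds mass_third; lra.
Qed.

Hypothesis cost_ge : forall x : G -> 'I_3 -> R,
  feasible M x -> M ^+ 2 / 4 <= fcost x.

(** Equality in Mantel's theorem makes the third class regular of degree [M / 2], which forces [m]
    to be even. The neighbourhoods of the ends of one of its edges are disjoint, so they fill it,
    and the degrees force a complete join. *)
Lemma extremal_blocks : exists (h : nat) X Y,
  [/\ m = (2 * h)%N, (0 < h)%N & blocks R h A1 A2 X Y].
Proof.
have M_gt0 : 0 < M by rewrite ltr0n.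
have q3 : M ^+ 2 / 2 <= qform (I A3) (I A3).
  by have := cost_ge feasible_thirds; rewrite fcost_thirds; lra.
have sum0 := mantel_sum tfG (ind_ge0 R A3); rewrite mass_third in sum0.
have sq0 z : 0 <= I A3 z * (mdeg (I A3) z - M / 2) ^+ 2.
  by rewrite mulr_ge0 ?ind_ge0 ?sqr_ge0.
have deg3 z : z \in A3 -> mdeg (I A3) z = M / 2.
  move=> z3; have : \sum_z I A3 z * (mdeg (I A3) z - M / 2) ^+ 2 = 0.
    apply/eqP; rewrite eq_le sumr_ge0 ?andbT //; apply: le_trans sum0 _.
    by apply: mulr_ge0_le0; lra.
  move/eqP; rewrite psumr_eq0 // => /allP/(_ z); rewrite mem_index_enum.
  move/(_ isT) => /=; rewrite {1}/ind z3 mul1r sqrf_eq0 subr_eq0.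
  by move/eqP.
have degE A z : mdeg (I A) z = #|nbr z :&: A|%:R.
  rewrite mdeg_nbr -mass_ind; apply: eq_mass => w.
  by rewrite /ind in_setI; do 2!case: (w \in _); rewrite ?(mul0r, mulr0, mulr1).
have [x0 x03] : exists x, x \in A3.
  by apply/card_gt0P; rewrite -(ltr_nat R) -mass_ind mass_third.
pose Y := nbr x0 :&: A3; have cY : #|Y|%:R = M / 2 by rewrite -degE deg3.
have m2 : m = (2 * #|Y|)%N.
  by apply/eqP; rewrite -(eqr_nat R) natrM cY; apply/eqP; field.
have h_gt0 : (0 < #|Y|)%N by lia.
have /card_gt0P[y0] := h_gt0; rewrite inE => /andP[y0x0 y03].
have x0y0 : adj x0 y0 by move: y0x0; rewrite inE.
pose X := nbr y0 :&: A3; have cX : #|X|%:R = M / 2 by rewrite -degE deg3.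
have iX : independent X.
  by apply: independentS (subsetIl _ _) _ => z w; apply: nbr_independent.
have iY : independent Y.
  by apply: independentS (subsetIl _ _) _ => z w; apply: nbr_independent.
have dXY z : z \in Y -> z \notin X.
  rewrite !inE => /andP[x0z _]; have := nbr_disjoint tfG x0y0 (v := z).
  by rewrite !inE => /(_ x0z)/negPf ->.
have XY3 : X :|: Y = A3.
  apply/eqP; rewrite eqEcard subUset !subsetIr /= -(ler_nat R) -!mass_ind.
  have -> : mass (I (X :|: Y)) = mass (I X) + mass (I Y).
    rewrite -massD; apply: eq_mass => z; have := dXY z; rewrite /ind in_setU.
    by case: (z \in Y) => [/(_ isT)/negPf ->|_]; rewrite ?orbF ?orbT ?add0r ?addr0.
  by rewrite !mass_ind -(mass_ind R A3) mass_third cX cY; lra.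
have I3 z : I A3 z = I X z + I Y z.
  rewrite -XY3; have := dXY z; rewrite /ind in_setU.
  by case: (z \in Y) => [/(_ isT)/negPf ->|_]; rewrite ?orbF ?orbT ?add0r ?addr0.
have H2 : 2 * #|Y|%:R = M by rewrite m2 natrM.
exists #|Y|, X, Y; split=> //; split.
- by move=> z; rewrite -(thirds z) I3 addrA.
- by split.
- by rewrite !mass_ind c1 c2 cX cY; split=> //; lra.
- move=> x y xX yY.
  have x3 : x \in A3 by rewrite -XY3 inE xX.
  apply: (@mdeg_full G R (I Y)) => [w||]; first exact: ind_ge0; last first.
    by rewrite /ind yY.
  have := deg3 x x3; rewrite (eq_mdeg x I3) mdegD.
  rewrite (@mdeg_eq0 G R X) => [|w wX]; last exact: iX.
  by rewrite add0r mass_ind cY => ->.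
Qed.

End TwoIndependent.

Section Isomorphism.
Variable h : nat.
Hypothesis h_gt0 : (0 < h)%N.
Hypothesis cardG : #|G| = (6 * h)%N.
Hypothesis cost_ge : forall x : G -> 'I_3 -> R,
  feasible (2 * h%:R) x -> h%:R ^+ 2 <= fcost x.

(** Everything outside [X] is joined to [X], hence lies in the neighbourhood of one vertex and is
    independent. *)
Lemma same_side A1 A2 X Y : blocks R h A1 A2 X Y ->
    (forall z x, z \in A1 -> x \in X -> adj z x) ->
    (forall z x, z \in A2 -> x \in X -> adj z x) ->
  isomorphic G (Kbip (5 * h) h).
Proof.
move=> [part [i1 i2 iX iY] [m1 m2 mX mY] cXY] a1 a2.
have cX : #|X| = h by apply/eqP; rewrite -(eqr_nat R) -mass_ind mX.
have adjX z x : z \in ~: X -> x \in X -> adj z x.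
  rewrite inE => zX xX; have := part z; rewrite /ind (negPf zX).
  case: (boolP (z \in A1)) => [/a1->//|_].
  case: (boolP (z \in A2)) => [/a2->//|_].
  case: (boolP (z \in Y)) => [zY _|_ /=]; first by rewrite adj_sym cXY.
  by move=> e; exfalso; lra.
have [x0 x0X] : exists x, x \in X by apply/card_gt0P; rewrite cX.
have iC : independent (~: X).
  move=> z w /adjX/(_ x0X) + /adjX/(_ x0X); rewrite !(adj_sym _ x0).
  by move=> zx wx; apply: (nbr_independent tfG (v := x0)); rewrite inE.
have cC : #|~: X| = (5 * h)%N by have := cardsC X; rewrite cX cardG; lia.
have := complete_bipartite_iso (S := ~: X); rewrite setCK cC cX; apply=> //.
by move=> z w zX; rewrite in_setC negbK; apply: adjX.
Qed.

(** The pairs [A1], [X], then [X], [Y], then [Y], [A2] are already completely joined; only the edges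
    between [A1] and [A2] remain to be found. *)
Lemma opposite_sides A1 A2 X Y : blocks R h A1 A2 X Y ->
    (forall z x, z \in A1 -> x \in X -> adj z x) ->
    (forall z y, z \in A2 -> y \in Y -> adj z y) ->
  isomorphic G (Kbip (3 * h) (3 * h)).
Proof.
move=> [part [i1 i2 iX iY] [m1 m2 mX mY] cXY] a1 a2.
have h0 : 0 < h%:R :> R by rewrite ltr0n.
pose P := A1 :|: Y.
have PE z : I P z = I A1 z + I Y z /\ I (~: P) z = I A2 z + I X z.
  have := part z; rewrite /ind !inE.
  by case: (z \in A1); case: (z \in A2); case: (z \in X); case: (z \in Y) => /= e;
    split; lra.
have mP : mass (I P) = 3 * h%:R.
  by rewrite (eq_mass (fun z => (PE z).1)) massD m1 mY; ring.
have mQ : mass (I (~: P)) = 3 * h%:R.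
  by rewrite (eq_mass (fun z => (PE z).2)) massD m2 mX; ring.
have [x0 x0X] : exists x, x \in X.
  by apply/card_gt0P; rewrite -(ltr_nat R) -mass_ind mX.
have [y0 y0Y] : exists y, y \in Y.
  by apply/card_gt0P; rewrite -(ltr_nat R) -mass_ind mY.
have iP : independent P.
  have aP z : z \in P -> adj x0 z.
    by rewrite inE => /orP[/a1/(_ x0X)|/(cXY _ _ x0X)//]; rewrite adj_sym.
  by move=> z w /aP zx /aP wx; apply: (nbr_independent tfG (v := x0)); rewrite inE.
have iQ : independent (~: P).
  have aQ z : z \in ~: P -> adj y0 z.
    rewrite adj_sym => zQ; have := (PE z).2; rewrite {1}/ind zQ /ind.
    case: (boolP (z \in A2)) => [/a2/(_ y0Y)//|_].
    by case: (boolP (z \in X)) => [/cXY/(_ y0Y)//|_ /= e]; exfalso; lra.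
  by move=> z w /aQ zx /aQ wx; apply: (nbr_independent tfG (v := y0)); rewrite inE.
have PQ1 z : 1 = I P z + I (~: P) z.
  by rewrite /ind in_setC; case: (z \in P) => /=; ring.
(* This colouring is cheaper than allowed unless [P] and its complement are
   completely joined. *)
pose f z := 2 / 3 * I P z; pose g z := 2 / 3 * I (~: P) z.
pose k z := 1 / 3 * (I P z + I (~: P) z).
have feas : feasible (2 * h%:R) (tricolour f g k).
  apply: feasible_tricolour => [z|z|z|z|||].
  - by rewrite mulr_ge0 ?ind_ge0 // divr_ge0.
  - by rewrite mulr_ge0 ?ind_ge0 // divr_ge0.
  - by rewrite /k -PQ1; lra.
  - by have := PQ1 z; rewrite /f /g /k; lra.
  - by rewrite massZ mP; field.
  - by rewrite massZ mQ; field.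
  - by rewrite massZ massD mP mQ; field.
(* The colouring costs one ninth of this form, whose largest possible value is the product [9 h^2]
   of the two sizes. *)
have qPQ : 9 * h%:R ^+ 2 <= qform (I P) (I (~: P)).
  have := cost_ge feas; rewrite fcost_tricolour !qformE.
  rewrite !qform_ind_independent // (qformC (I (~: P)) (I P)); lra.
have cPQ z w : z \in P -> w \notin P -> adj z w.
  move=> zP wP; have degP v : mdeg (I (~: P)) v <= 3 * h%:R.
    by rewrite -mQ; apply: mdeg_le_mass => y; apply: ind_ge0.
  apply: (@mdeg_full G R (I (~: P))) => [y||]; first exact: ind_ge0; last first.
    by rewrite /ind inE wP.
  rewrite mQ leNgt; apply/negP=> lt_z.
  suff : qform (I P) (I (~: P)) < mass (fun v => 3 * h%:R * I P v).
    by rewrite massZ mP => lt9; move: qPQ lt9; rewrite expr2; lra.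
  rewrite /qform /mass (bigD1 z) //= [ltRHS](bigD1 z) //=.
  apply: ltr_leD; first by rewrite /ind zP mul1r mulr1.
  apply: ler_sum => v _; rewrite mulrC.
  by apply: ler_wpM2r (degP v); apply: ind_ge0.
have cP : #|P| = (3 * h)%N.
  by apply/eqP; rewrite -(eqr_nat R) -mass_ind mP natrM.
have cQ : #|~: P| = (3 * h)%N by have := cardsC P; rewrite cP cardG; lia.
by rewrite -{1}cP -cQ; apply: complete_bipartite_iso.
Qed.

Lemma extremal_iso A1 A2 X Y : blocks R h A1 A2 X Y ->
  isomorphic G (Kbip (5 * h) h) \/ isomorphic G (Kbip (3 * h) (3 * h)).
Proof.
move=> bl.
have [a1|a1] := attached tfG h_gt0 cost_ge bl;
have [a2|a2] := attached tfG h_gt0 cost_ge (blocksC bl).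
- by left; apply: same_side bl a1 a2.
- by right; apply: opposite_sides bl a1 a2.
- by right; apply: opposite_sides (blocksX bl) a1 a2.
- by left; apply: same_side (blocksX bl) a1 a2.
Qed.

End Isomorphism.
End Extremal.

(** * Assembly of the cases *)

Lemma two_independent_or_lt (G : sgraph) (R : rcfType) (m : nat) :
    triangle_free G -> #|G| = (3 * m)%N -> (0 < m)%N ->
  (exists A1 A2 : {set G}, [/\ independent A1, independent A2, #|A1| = m,
     #|A2| = m & [disjoint A1 & A2]]) \/
  (Dbal 3 G)%:R < m%:R ^+ 2 / 4 :> R.
Proof.
move=> tfG cardG m_gt0.
have [sparse|dense] := lerP (qform (fun _ : G => 1) (fun _ => 1))
                            (3 / 2 * m%:R ^+ 2 : R).
  by right; apply: sparse_lt.
have [/existsP[A /andP[mA /forall_inP iA]]|noA] := boolP [exists A : {set G},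
    (m <= #|A|)%N && [forall z in A, forall w in A, ~~ adj z w]]; last first.
  right; apply: small_independence_lt => // A iA; rewrite ltnNge.
  apply: contra noA => mA; apply/existsP; exists A; rewrite mA /=.
  exact/independentP.
have /independentP {}iA : [forall z in A, forall w in A, ~~ adj z w].
  exact/forall_inP.
have [A1 A1A c1] := subset_of_card mA; have i1 := independentS A1A iA.
have [/existsP[B /and3P[BA mB /independentP iB]]|noB] := boolP [exists B : {set G},
    [&& B \subset ~: A1, (m <= #|B|)%N
      & [forall z in B, forall w in B, ~~ adj z w]]]; last first.
  right; apply: one_independent_lt i1 c1 _ => // B BA iB; rewrite ltnNge.
  apply: contra noB => mB; apply/existsP; exists B; rewrite BA mB /=.
  exact/independentP.
have [A2 A2B c2] := subset_of_card mB; have i2 := independentS A2B iB.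
left; exists A1, A2; split=> //.
by rewrite disjoint_sym disjoints_subset (subset_trans A2B).
Qed.

Lemma Dbal_le (G : sgraph) (m : nat) :
    triangle_free G -> #|G| = (3 * m)%N -> (0 < m)%N ->
  (4 * Dbal 3 G <= m ^ 2)%N.
Proof.
(* The Perron vector requires a real closed field; [realalg] is a concrete one. *)
move=> tfG cardG m_gt0; rewrite -(ler_nat realalg) natrM natrX.
have [[A1 [A2 [i1 i2 c1 c2 d12]]]|] := two_independent_or_lt realalg tfG cardG m_gt0.
  by have := two_independent_le realalg tfG i1 i2 c1 c2 d12 cardG; lra.
by lra.
Qed.

Lemma Dbal_eq (G : sgraph) (m : nat) :
    triangle_free G -> #|G| = (3 * m)%N -> (0 < m)%N ->
    (4 * Dbal 3 G)%N = (m ^ 2)%N ->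
  exists2 h, m = (2 * h)%N &
    isomorphic G (Kbip (5 * h) h) \/ isomorphic G (Kbip (3 * h) (3 * h)).
Proof.
move=> tfG cardG m_gt0 eqD.
have eqDR : (Dbal 3 G)%:R = m%:R ^+ 2 / 4 :> realalg.
  by have := congr1 (fun k => k%:R : realalg) eqD; rewrite natrM natrX; lra.
have cost_ge (x : G -> 'I_3 -> realalg) : feasible m%:R x ->
    m%:R ^+ 2 / 4 <= fcost x.
  by move=> fx; rewrite -eqDR (Dbal_le_fcost fx).
have [[A1 [A2 [i1 i2 c1 c2 d12]]]|] := two_independent_or_lt realalg tfG cardG m_gt0;
  last by rewrite eqDR ltxx.
have [h [X [Y [m2 h_gt0 bl]]]] :=
  extremal_blocks tfG i1 i2 c1 c2 d12 cardG m_gt0 cost_ge.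
exists h => //; apply: extremal_iso bl => //; first by rewrite cardG m2 mulnA.
move=> x fx; have := cost_ge x; rewrite m2 natrM => /(_ fx).
by rewrite exprMn; lra.
Qed.

Local Close Scope ring_scope.

(* D_3^b(G) is an integer, so in the equality case 6 divides n and the
   natural-number divisions below are exact. *)
Theorem theorem1p6 :
  exists n0 : nat, forall n : nat, n0 <= n -> 3 %| n ->
  forall G : sgraph, #|G| = n -> triangle_free G ->
    (((Dbal 3 G)%:R <= n%:R ^+ 2 / 36%:R :> rat)%R) /\
    (((Dbal 3 G)%:R = n%:R ^+ 2 / 36%:R :> rat)%R ->
       isomorphic G (Kbip ((5 * n) %/ 6) (n %/ 6)) \/
       isomorphic G (Kbip (n %/ 2) (n %/ 2))).
Proof.
(* Only the empty graph is excluded: nothing in the argument is asymptotic. *)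
exists 1 => n n_gt0 /dvdnP[m nE] G cardG tfG.
have m_gt0 : 0 < m by lia.
have {}cardG : #|G| = 3 * m by rewrite cardG nE mulnC.
have nR : (n%:R ^+ 2 / 36%:R = m%:R ^+ 2 / 4 :> rat)%R.
  by rewrite nE natrM; field.
rewrite nR; split=> [|eqD].
  have := Dbal_le tfG cardG m_gt0; rewrite -(ler_nat rat) natrM natrX; lra.
have [|h mE iso] := Dbal_eq tfG cardG m_gt0.
  by apply/eqP; rewrite -(eqr_nat rat) natrM natrX eqD; apply/eqP; field.
have -> : 5 * n %/ 6 = 5 * h by lia.
have -> : n %/ 6 = h by lia.
by have -> : n %/ 2 = 3 * h by lia.
Qed.
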